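(* Let $L/\mathbb{Q}$ be a finite abelian extension of the rational numbers, with $L\subset\mathbb{C}$. Let $f$ be the smallest positive integer such that $L$ is contained in the $f$-th cyclotomic field $\mathbb{Q}_f$ (the conductor of $L$). Let $H$ be the subgroup of the Galois group $\mathrm{Gal}(\mathbb{Q}_f/\mathbb{Q})$ which fixes $L$. Then there is an integral basis of $L$ (i.e. a $\mathbb{Z}$-basis of the ring of algebraic integers of $L$) which consists of orbit sums of $H$ on $f$-th roots of unity.
   Context: $\mathbb{Q}_f=\mathbb{Q}(\zeta_f)$ with $\zeta_f=\exp(2\pi i/f)$. The group $H$ acts on the set $\langle\zeta_f\rangle$ of $f$-th roots of unity in $\mathbb{C}$. An orbit sum is an element $\sum_{\eta\in O}\eta$, where $O$ is an $H$-orbit on $\langle\zeta_f\rangle$. *)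

(* Defs.v *)
From HB Require Import structures.
From mathcomp Require Import all_boot all_order all_algebra all_fingroup all_field.
From mathcomp Require Import reals trigo.
From mathcomp.real_closed Require Import complex.

Set Implicit Arguments.
Unset Strict Implicit.
Unset Printing Implicit Defensive.

Import GRing.Theory.
Local Open Scope ring_scope.
Local Open Scope complex_scope.

(* exp(2 i pi / m) *)
Definition zeta (R : realType) (m : nat) : R[i] :=
  cos (2 * pi / m%:R) +i* sin (2 * pi / m%:R).

(* The subfield Q(zeta_m) of the complex numbers. *)
Definition cyclotomic_field (R : realType) (m : nat) (x : R[i]) : Prop :=
  exists p q : {poly rat},
    (map_poly ratr q).[zeta R m] != 0 /\
    x = (map_poly ratr p).[zeta R m] / (map_poly ratr q).[zeta R m].

(* A number field in the complex numbers is encoded as a subfield L of a       *)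
(* finite extension E of Q with an embedding iota of E into R[i]. Membership in *)
(* Q(zeta_m) is tested in R[i] since E need not contain zeta_m.                *)
Definition in_cyclotomic_field (R : realType) (E : fieldExtType rat)
    (iota : {rmorphism E -> R[i]}) (L : {subfield E}) (m : nat) : Prop :=
  forall x : E, x \in L -> cyclotomic_field m (iota x).

Definition is_conductor (R : realType) (E : fieldExtType rat)
    (iota : {rmorphism E -> R[i]}) (L : {subfield E}) (f : nat) : Prop :=
  [/\ (0 < f)%N,
      in_cyclotomic_field iota L f &
      forall m : nat, (0 < m)%N -> in_cyclotomic_field iota L m -> (f <= m)%N].

Definition ring_of_integers (E : fieldExtType rat) (L : {subfield E}) (x : E)
    : Prop :=
  x \in L /\ integralOver (intr : int -> E) x.

Definition is_Z_basis (V : zmodType) (M : V -> Prop) (n : nat) (b : 'I_n -> V)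
    : Prop :=
  (forall c : 'I_n -> int, \sum_i b i *~ c i = 0 -> forall i, c i = 0) /\
  (forall x : V, M x <-> exists c : 'I_n -> int, x = \sum_i b i *~ c i).

(* undup: an element of the orbit counts once, even if its stabiliser in H is  *)
(* not trivial, so this is not a trace in general.                             *)
Definition orbit_sum (E : splittingFieldType rat) (F : {subfield E})
    (H : {set gal_of F}) (eta : E) : E :=
  \sum_(x <- undup [seq s eta | s : gal_of F in H]) x.

(* Main.v *)
Require Import Defs.
From HB Require Import structures.
From mathcomp Require Import all_boot all_order all_algebra all_fingroup all_field.
From mathcomp Require Import cyclic ring lra reals trigo.
From mathcomp.real_closed Require Import complex.

(** The extension [K = Q(z)], with [z] a primitive [f]-th root of unity, is
    Galois over [L] with group [H], and its integers form the ring [Z[z]]. So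
    the integers of [L] are the elements of [Z[z]] fixed by [H], and it is enough
    to find a Z-basis of [Z[z]] that consists of [f]-th roots of unity and is
    adapted to the action of [H].

    That [Z[z]] contains every integer of [K] is shown one prime [q] at a time
    ([cyclotomic_integers]): for a suitable [lam] dividing [q], with a power of
    [lam] divisible by [q], the [q ^ k]-th power map is the identity on
    [Z[z] / lam] for some [k > 0]. This ring is therefore reduced. If [x] is
    integral and [lam * x] lies in [Z[z]], then a power of [lam * x] is
    divisible by [lam]; hence so is [lam * x], and [x] lies in [Z[z]].

    For the basis, call a root of unity full if its order is divisible by all
    primes dividing [f]. As the [p]-th roots of unity sum to zero, the full roots
    span [Z[z]]. Attach to a full root [y] of order [s] the product [m] of the
    primes [p] with [p ^ 2] dividing [s], and let the block of [y] be the set of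
    the [y * v] with [v ^ m = 1]. The blocks are permuted by [H]. An automorphism
    mapping [y] into its own block raises [y] to a power [a] with [p] dividing
    [a - 1] for all [p] dividing [m]. So it fixes the [v] with [v ^ m = 1], and
    on the space spanned by the block it is multiplication by a root of unity [u]
    ([block_scalar]).

    After the choice of a base point [beta] in a block, the roots [beta * v] with
    [v] a primitive [m]-th root of unity span the block over [Z]. All blocks
    together provide at most [totient f] such roots ([size_based]), and
    [totient f] is the degree of [K]. So these roots are a Z-basis of [Z[z]], and
    [K] is the direct sum of the spaces spanned by the blocks ([block_direct]).

    Call a block rigid if the automorphisms in [H] preserving it act on it
    trivially. If a block is not rigid, then an element fixed by [H] has a
    component in it that is multiplied by some [u <> 1], hence zero
    ([fixed_nonrigid_coef]). On the rigid blocks the base points can be chosen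
    [H]-equivariantly ([base_point_gal]): the basis vectors in rigid blocks are
    then permuted by [H], and an element fixed by [H] has constant coefficients
    on the orbits ([fixed_rigid_coef]). The sums of these orbits are the required
    basis. *)

Set Implicit Arguments.
Unset Strict Implicit.
Unset Printing Implicit Defensive.

Import Order.TTheory GRing.Theory Num.Theory.
Local Open Scope ring_scope.
Local Open Scope complex_scope.

(** * Cyclotomic fields *)

Lemma cis_add (R : realType) (a b : R) :
  (cos a +i* sin a) * (cos b +i* sin b) = cos (a + b) +i* sin (a + b).
Proof.
rewrite cosD sinD [LHS]/=; apply/eqP; rewrite eq_complex /=.
by rewrite eqxx /= addrC eqxx.
Qed.

Lemma zetaX (R : realType) (f k : nat) :
  zeta R f ^+ k
  = cos (k%:R * (2 * pi / f%:R)) +i* sin (k%:R * (2 * pi / f%:R)).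
Proof.
elim: k => [|k IHk]; first by rewrite mul0r cos0 sin0 expr0.
rewrite exprS IHk cis_add; set t : R := 2 * pi / f%:R.
by rewrite -[k.+1]add1n natrD mulrDl mul1r.
Qed.

Lemma zeta_primitive (R : realType) (f : nat) :
  (0 < f)%N -> f.-primitive_root (zeta R f).
Proof.
move=> f_gt0; have f0 : f%:R != 0 :> R by rewrite pnatr_eq0 -lt0n.
rewrite /primitive_root_of_unity f_gt0 /=; apply/forallP => i; apply/eqP.
rewrite unity_rootE zetaX; have [-> | neq_if] := eqVneq i.+1 f.
  rewrite mulrCA divff // mulr1 mulr_natl cos2pi sin2pi.
  by rewrite eq_complex /= !eqxx.
have lt_if : (i.+1 < f)%N by rewrite ltn_neqAle neq_if ltn_ord.
apply/negbTE; rewrite eq_complex /= negb_and; apply/orP; left.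
(* cos (2 t) = 1 - (sin t) ^ 2 * 2 differs from 1, since 0 < t < pi. *)
set t : R := i.+1%:R * (pi / f%:R).
have -> : i.+1%:R * (2 * pi / f%:R) = t *+ 2 by rewrite /t -mulr_natl; ring.
have st : 0 < sin t.
  apply: sin_gt0_pi; rewrite /t; apply/andP; split.
    by rewrite mulr_gt0 ?divr_gt0 ?pi_gt0 ?ltr0n.
  by rewrite mulrCA gtr_pMr ?pi_gt0 // ltr_pdivrMr ?ltr0n // mul1r ltr_nat.
rewrite cos_mulr2n lt_eqF //.
have := cos2Dsin2 t; have : 0 < sin t ^+ 2 by rewrite exprn_gt0.
lra.
Qed.

Lemma cyclotomic_field_adjoin (R : realType) (E : fieldExtType rat)
    (iota : {rmorphism E -> R[i]}) (f : nat) (z x : E) :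
  iota z = zeta R f -> cyclotomic_field f (iota x) -> x \in <<1; z>>%VS.
Proof.
move=> iz [p [q [q0 Dx]]].
have ev (g : {poly rat}) :
    (map_poly ratr g).[zeta R f] = iota (map_poly (in_alg E) g).[z].
  rewrite -horner_map /= iz -map_poly_comp; congr (_.[_]).
  by apply: eq_map_poly => a /=; rewrite -(fmorph_eq_rat (iota \o in_alg E)).
have inK (g : {poly rat}) : (map_poly (in_alg E) g).[z] \in <<1; z>>%VS.
  by apply: mempx_Fadjoin; apply: alg_polyOver.
suff -> : x = (map_poly (in_alg E) p).[z] / (map_poly (in_alg E) q).[z].
  by rewrite rpred_div ?inK.
by apply: (fmorph_inj iota); rewrite Dx !ev fmorph_div.
Qed.

Lemma galois_cyclotomic (E : splittingFieldType rat) (f : nat) (z : E) :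
  f.-primitive_root z -> galois 1 <<1; z>>.
Proof.
move=> prz; have f_gt0 := prim_order_gt0 prz.
apply/splitting_galoisField; exists ('X^f - 1); split.
- by rewrite rpredB ?rpred1 // rpredX // polyOverX.
- by apply: separable_Xn_sub_1; apply: prim_root_natf_neq0 prz.
exists [seq z ^+ i | i <- index_iota 0 f].
  by rewrite big_map (factor_Xn_sub_1 prz) eqpxx.
apply/eqP; rewrite eqEsubv; apply/andP; split.
  apply/Fadjoin_seqP; split; first exact: subv_adjoin.
  by move=> _ /mapP[i _ ->]; rewrite rpredX // memv_adjoin.
apply/FadjoinP; split; first exact: subv_adjoin_seq.
apply: seqv_sub_adjoin; apply/mapP; exists (1 %% f)%N.
  by rewrite mem_index_iota /= ltn_mod.
by rewrite (prim_expr_mod prz).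
Qed.

(** A root [w] in [algC] of the minimal polynomial of [z] annihilates the same
    rational polynomials as [z]: it is a primitive [f]-th root of unity, and the
    known minimal polynomial of [w] over [Q] has degree [totient f]. *)
Lemma dim_cyclotomic_ge (E : fieldExtType rat) (f : nat) (z : E) :
  f.-primitive_root z -> (totient f <= \dim <<1; z>>)%N.
Proof.
move=> prz; have f_gt0 := prim_order_gt0 prz.
rewrite dim_Fadjoin dimv1 muln1.
have /polyOver1P[g Dg] := minPolyOver 1 z.
have sg : size g = (adjoin_degree 1 z).+1.
  by rewrite -(size_minPoly 1 z) Dg size_map_poly.
have g0 : g != 0 by rewrite -size_poly_eq0 sg.
have gz : root (map_poly (in_alg E) g) z by rewrite -Dg root_minPoly.
have [w gw] : exists w : algC, root (map_poly ratr g) w.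
  by apply/closed_rootP; rewrite size_map_poly sg.
pose QtoE := map_poly (in_alg E); pose QtoC := map_poly (ratr : rat -> algC).
have same_roots (h : {poly rat}) : root (QtoC h) w = root (QtoE h) z.
  apply/idP/idP => [hw | hz]; last first.
    have : minPoly 1 z %| QtoE h by apply: minPoly_dvdp => //; apply: alg_polyOver.
    by rewrite Dg dvdp_map => /dvdpP[k ->]; rewrite /QtoC rmorphM rootM gw orbT.
  have dw : root (QtoC (gcdp g h)) w by rewrite /QtoC gcdp_map root_gcd gw.
  have : QtoE (gcdp g h) %| minPoly 1 z by rewrite Dg dvdp_map dvdp_gcdl.
  case/(minPoly_irr (alg_polyOver _ _))/orP => [eqg | eq1].
    have : root (QtoE (gcdp g h)) z by rewrite (eqp_root eqg) root_minPoly.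
    by rewrite /QtoE gcdp_map root_gcd => /andP[].
  move: eq1 dw; rewrite -size_poly_eq1 size_map_poly => /size_poly1P[c c0 ->].
  by rewrite /QtoC map_polyC /= rootC fmorph_eq0 (negPf c0).
have prw : f.-primitive_root w.
  rewrite /primitive_root_of_unity f_gt0; apply/forallP => i.
  have /andP[_ /forallP/(_ i)/eqP <-] := prz.
  have := same_roots ('X^(i.+1) - 1).
  rewrite /QtoC /QtoE !rmorphB /= !rmorph1 !map_polyXn /root !hornerE !unity_rootE.
  by rewrite !subr_eq0 => ->.
have [p [Dp _ pP]] := minCpolyP w.
have := pP g; rewrite gw => /esym/dvdp_leq - /(_ g0).
rewrite sg -(size_map_poly (ratr : {rmorphism rat -> algC})) -Dp.
by rewrite (minCpoly_cyclotomic prw) size_cyclotomic ltnS.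
Qed.

(** * The subring generated by an element, and congruences in it *)

Definition Zadjoin (E : nzRingType) (z x : E) : Prop :=
  exists p : {poly int}, x = (map_poly intr p).[z].

Section Zadjoin.

Variables (E : fieldType) (z : E).
Local Notation A := (Zadjoin z).

Lemma Zadjoin_int (n : int) : A n%:~R.
Proof. by exists n%:P; rewrite map_polyC hornerC. Qed.

Lemma Zadjoin_nat (n : nat) : A n%:R.
Proof. exact: (Zadjoin_int n). Qed.

Lemma Zadjoin_gen : A z.
Proof. by exists 'X; rewrite map_polyX hornerX. Qed.

Lemma ZadjoinD x y : A x -> A y -> A (x + y).
Proof. by move=> [p ->] [q ->]; exists (p + q); rewrite rmorphD hornerD. Qed.

Lemma ZadjoinN x : A x -> A (- x).
Proof. by move=> [p ->]; exists (- p); rewrite rmorphN hornerN. Qed.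

Lemma ZadjoinM x y : A x -> A y -> A (x * y).
Proof. by move=> [p ->] [q ->]; exists (p * q); rewrite rmorphM hornerM. Qed.

Lemma ZadjoinB x y : A x -> A y -> A (x - y).
Proof. by move=> Ax Ay; apply: ZadjoinD => //; apply: ZadjoinN. Qed.

Lemma ZadjoinX x n : A x -> A (x ^+ n).
Proof.
move=> Ax; elim: n => [|n IHn]; first exact: (Zadjoin_nat 1).
by rewrite exprS; apply: ZadjoinM.
Qed.

Lemma Zadjoin_sum (I : Type) (r : seq I) (P : pred I) (F : I -> E) :
  (forall i, P i -> A (F i)) -> A (\sum_(i <- r | P i) F i).
Proof.
move=> AF; apply: big_ind => //; [exact: (Zadjoin_nat 0) | exact: ZadjoinD].
Qed.

Lemma Zadjoin_Mn x n : A x -> A (x *+ n).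
Proof. by move=> Ax; rewrite -mulr_natr; apply/ZadjoinM/Zadjoin_nat. Qed.

Definition Zcong (lam x y : E) : Prop := exists2 a, A a & x - y = lam * a.

Section Congruence.

Variable lam : E.
Local Notation cg := (Zcong lam).

Lemma Zcong_refl x : cg x x.
Proof. by exists 0; [exact: (Zadjoin_nat 0) | rewrite subrr mulr0]. Qed.

Lemma Zcong_sym x y : cg x y -> cg y x.
Proof.
by case=> a Aa e; exists (- a); rewrite ?mulrN -?e ?opprB //; apply: ZadjoinN.
Qed.

Lemma Zcong_trans y x t : cg x y -> cg y t -> cg x t.
Proof.
move=> [a Aa e] [b Ab e']; exists (a + b); first exact: ZadjoinD.
by rewrite mulrDr -e -e' addrA subrK.
Qed.

Lemma ZcongD x y x' y' : cg x x' -> cg y y' -> cg (x + y) (x' + y').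
Proof.
move=> [a Aa e] [b Ab e']; exists (a + b); first exact: ZadjoinD.
by rewrite mulrDr -e -e' opprD addrACA.
Qed.

Lemma ZcongM x y x' y' :
  A x -> A y' -> cg x x' -> cg y y' -> cg (x * y) (x' * y').
Proof.
move=> Ax Ay' [a Aa e] [b Ab e']; exists (a * y' + x * b).
  by apply: ZadjoinD; apply: ZadjoinM.
transitivity ((x - x') * y' + x * (y - y')); first by ring.
by rewrite e e'; ring.
Qed.

Lemma ZcongX x y n : A x -> A y -> cg x y -> cg (x ^+ n) (y ^+ n).
Proof.
move=> Ax Ay e; elim: n => [|n IHn]; first exact: Zcong_refl.
by rewrite !exprS; apply: ZcongM => //; apply: ZadjoinX.
Qed.

Variable q : nat.
Hypotheses (q_pr : prime q) (q_lam : cg q%:R 0).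

Lemma Zcong_Mn x n : A x -> (q %| n)%N -> cg (x *+ n) 0.
Proof.
move=> Ax /dvdnP[k ->]; have [a Aa] := q_lam; rewrite subr0 => e.
exists (a * (x *+ k)); first by apply/ZadjoinM/Zadjoin_Mn.
by rewrite subr0 mulrA -e mulr_natl mulrnA.
Qed.

(** The inner binomial coefficients [binomial q i] are divisible by [q]. *)
Lemma Zcong_exprD x y k : A x -> A y ->
  cg ((x + y) ^+ (q ^ k)%N) (x ^+ (q ^ k)%N + y ^+ (q ^ k)%N).
Proof.
move=> Ax Ay; elim: k => [|k IHk]; first by rewrite expn0 !expr1; apply: Zcong_refl.
rewrite expnSr !exprM; set X := x ^+ _ in IHk *; set Y := y ^+ _ in IHk *.
have [AX AY] : A X /\ A Y by split; apply: ZadjoinX.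
apply: (@Zcong_trans ((X + Y) ^+ q)).
  by apply: ZcongX => //; [apply/ZadjoinX/ZadjoinD | apply: ZadjoinD].
have [r Dq] : exists r, q = r.+1 by exists q.-1; rewrite prednK ?prime_gt0.
rewrite exprDn Dq big_ord_recl big_ord_recr /= subn0 bin0 subnn binn.
rewrite !expr0 mul1r mulr1 !mulr1n; apply: ZcongD; first exact: Zcong_refl.
rewrite -[Z in cg _ Z]add0r; apply: ZcongD; last exact: Zcong_refl.
elim/big_rec: _ => [|i u _ IHu]; first exact: Zcong_refl.
rewrite -[0]addr0; apply: ZcongD => //; apply: Zcong_Mn.
  by apply: ZadjoinM; apply: ZadjoinX.
by rewrite -Dq prime_dvd_bin //= Dq /bump add1n ltnS ltn_ord.
Qed.

Variable K : nat.
Hypothesis z_fix : cg (z ^+ (q ^ K)%N) z.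

(** The [q ^ K]-th power map is additive modulo [lam], hence a ring endomorphism
    of [A / lam]; it fixes the generator [z], so that it is the identity. *)
Lemma Zcong_Frobenius x : A x -> cg (x ^+ (q ^ K)%N) x.
Proof.
have fixD a b : A a -> A b -> cg (a ^+ (q ^ K)%N) a -> cg (b ^+ (q ^ K)%N) b ->
    cg ((a + b) ^+ (q ^ K)%N) (a + b).
  move=> Aa Ab ea eb; apply: Zcong_trans (Zcong_exprD K Aa Ab) _.
  exact: ZcongD.
have fixM a b : A a -> A b -> cg (a ^+ (q ^ K)%N) a -> cg (b ^+ (q ^ K)%N) b ->
    cg ((a * b) ^+ (q ^ K)%N) (a * b).
  by move=> Aa Ab ea eb; rewrite exprMn; apply: ZcongM => //; apply: ZadjoinX.
have fix_nat n : cg (n%:R ^+ (q ^ K)%N) n%:R.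
  elim: n => [|n IHn].
    by rewrite expr0n expn_eq0 eqn0Ngt prime_gt0 //=; apply: Zcong_refl.
  rewrite -addn1 natrD; apply: fixD => //; try exact: Zadjoin_nat.
  by rewrite expr1n; apply: Zcong_refl.
have fixN a : A a -> cg (a ^+ (q ^ K)%N) a -> cg ((- a) ^+ (q ^ K)%N) (- a).
  (* Modulo lam, - 1 is the natural number q - 1. *)
  move=> Aa ea; have eN : cg (- a) (q.-1%:R * a).
    have Dq : q%:R = q.-1%:R + 1 :> E by rewrite natr1 prednK ?prime_gt0.
    have := ZcongM (Zadjoin_nat q) Aa q_lam (Zcong_refl a).
    rewrite mul0r Dq mulrDl mul1r => e; apply: Zcong_sym.
    by have := ZcongD e (Zcong_refl (- a)); rewrite add0r addrK.
  have Aqa : A (q.-1%:R * a) by apply: ZadjoinM => //; apply: Zadjoin_nat.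
  apply: Zcong_trans (Zcong_sym eN).
  apply: Zcong_trans (ZcongX _ (ZadjoinN Aa) Aqa eN) _.
  by apply: fixM => //; apply: Zadjoin_nat.
case=> p ->; elim/poly_ind: p => [|p c IHp].
  by rewrite rmorph0 horner0; apply: (fix_nat 0).
have Ap : A (map_poly intr p).[z] by exists p.
rewrite rmorphD rmorphM /= map_polyX map_polyC hornerMXaddC.
apply: fixD.
- by apply: ZadjoinM => //; apply: Zadjoin_gen.
- exact: Zadjoin_int.
- by apply: fixM => //; apply: Zadjoin_gen.
case: c => n; first exact: fix_nat.
rewrite NegzE /= mulrNz; apply: fixN; [exact: Zadjoin_nat | exact: fix_nat].
Qed.

Hypotheses (K_gt0 : (0 < K)%N) (Alam : A lam) (lam0 : lam != 0).

(** An integral equation for [x] shows that [lam] divides a power of [lam * x].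
    By the previous lemma [A / lam] is reduced, so [lam] divides [lam * x]. *)
Lemma Zadjoin_divl x :
  integralOver (intr : int -> E) x -> A (lam * x) -> A x.
Proof.
move=> [p mon_p px] Ay; set y := lam * x in Ay *.
have [n sp] : exists n, size p = n.+2.
  case sp: (size p) => [|[|n]]; last by exists n.
    by move: (monic_neq0 mon_p); rewrite -size_poly_eq0 sp.
  have := px; have /eqP := sp => /size_poly1P[c c0 Dp].
  rewrite Dp; move: mon_p; rewrite Dp monicE lead_coefC => /eqP ->.
  by rewrite map_polyC /= rootC oner_eq0.
have yn : cg (y ^+ n.+1) 0.
  have sz : (size (map_poly intr p : {poly E}) <= n.+2)%N by rewrite -sp size_poly.
  move/eqP: px; rewrite (horner_coef_wide _ sz) big_ord_recr /=.
  have lead1 : p`_n.+1 = 1 by move/monicP: mon_p; rewrite lead_coefE sp.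
  rewrite coef_map /= lead1 mul1r => /eqP.
  rewrite addrC addr_eq0 => /eqP xn.
  exists (- \sum_(i < n.+1) (p`_i)%:~R * lam ^+ (n - i) * y ^+ i).
    apply/ZadjoinN/Zadjoin_sum => i _; apply: ZadjoinM; last exact: ZadjoinX.
    by apply: ZadjoinM; [exact: Zadjoin_int | exact: ZadjoinX].
  rewrite subr0 /y exprMn xn !mulrN; congr (- _); rewrite !mulr_sumr.
  apply: eq_bigr => i _; rewrite coef_map /= exprMn.
  rewrite -{1}(subnK (leq_ord i)) -addSn exprD exprS; ring.
have yQ M : cg (y ^+ ((q ^ K) ^ M)%N) y.
  elim: M => [|M IHM]; first by rewrite expn0 expr1; apply: Zcong_refl.
  rewrite expnSr exprM; apply: Zcong_trans (Zcong_Frobenius Ay).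
  by apply: ZcongX => //; apply: ZadjoinX.
have [a Aa] : cg y 0.
  apply: Zcong_trans (Zcong_sym (yQ n.+1)) _.
  have lt : (n.+1 < (q ^ K) ^ n.+1)%N.
    rewrite ltn_expl // (leq_trans (prime_gt1 q_pr)) //.
    by rewrite -{1}(expn1 q) leq_exp2l ?prime_gt1.
  rewrite -(subnK (ltnW lt)) exprD; set u := y ^+ (_ - _).
  rewrite -[0](mulr0 u); apply: ZcongM => //.
  - exact: ZadjoinX.
  - exact: (Zadjoin_nat 0).
  exact: Zcong_refl.
by rewrite subr0 => /(mulfI lam0) ->.
Qed.

End Congruence.
End Zadjoin.

(** * Integers of cyclotomic fields *)

Lemma integral_unity_root (E : fieldType) (f : nat) (x : E) :
  (0 < f)%N -> x ^+ f = 1 -> integralOver (intr : int -> E) x.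
Proof.
move=> f_gt0 xf; exists ('X^f - 1); first exact: monicXnsubC.
by rewrite rmorphB /= map_polyXn rmorph1 rootE !hornerE xf subrr.
Qed.

Section CyclotomicIntegers.

Variables (E : fieldExtType rat) (f : nat) (z : E).
Hypothesis prz : f.-primitive_root z.
Let f_gt0 : (0 < f)%N := prim_order_gt0 prz.
Local Notation A := (Zadjoin z).
Local Notation integral := (integralOver (intr : int -> E)).

Lemma Zadjoin_integral x : A x -> integral x.
Proof.
case=> p ->; apply: integral_horner.
  by apply/integral_poly => i; rewrite coef_map; apply: integral_id.
by apply: integral_unity_root f_gt0 _; apply: prim_expr_order.
Qed.

(** The ring [A / q] is reduced since [z ^+ (q ^ totient f) = z]. *)
Lemma Zadjoin_divl_coprime (q : nat) (x : E) : prime q -> coprime q f ->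
  integral x -> A (q%:R * x) -> A x.
Proof.
move=> q_pr qf intx; apply: (@Zadjoin_divl _ _ _ q _ _ (totient f)) => //.
- by exists 1; [exact: (Zadjoin_nat _ 1) | rewrite subr0 mulr1].
- suff -> : z ^+ (q ^ totient f)%N = z by apply: Zcong_refl.
  rewrite -[RHS]expr1; apply/eqP; rewrite (eq_prim_root_expr prz).
  by apply/eqP; apply: Euler_exp_totient.
- by rewrite totient_gt0.
- exact: Zadjoin_nat.
by rewrite -(rmorph_nat (in_alg E)) fmorph_eq0 pnatr_eq0 -lt0n prime_gt0.
Qed.

(** Let [w] be a primitive root of unity whose order is the [q]-part of [f], and
    [lam = 1 - w]. The [q]-th roots of unity sum to zero and are powers of [w],
    thus congruent to [1] modulo [lam]: this gives [lam %| q]. In the other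
    direction [lam ^+ f`_q] is divisible by [q], by additivity of the power map
    applied to [lam + w = 1]. *)
Lemma Zadjoin_divl_dvd (q : nat) (x : E) : prime q -> (q %| f)%N ->
  integral x -> A (q%:R * x) -> A x.
Proof.
move=> q_pr qf intx Aqx; pose n := (f`_q^')%N; pose w := z ^+ n; pose lam := 1 - w.
have n_gt0 : (0 < n)%N := part_gt0 _ _.
have fE : (f`_q * n)%N = f := partnC q f_gt0.
have Aw : A w by apply/ZadjoinX/Zadjoin_gen.
have Alam : A lam by apply: ZadjoinB => //; exact: (Zadjoin_nat _ 1).
have w1 : Zcong z lam w 1.
  by exists (-1); [apply: ZadjoinN; exact: (Zadjoin_nat _ 1) | rewrite mulrN1 opprB].
have wX j : Zcong z lam (w ^+ j) 1.
  by rewrite -(expr1n _ j); apply: ZcongX => //; exact: (Zadjoin_nat _ 1).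
have q_f : (q %| f`_q)%N.
  by rewrite p_part -{1}(expn1 q) dvdn_exp2l // logn_gt0 mem_primes q_pr f_gt0.
have lam0 : lam != 0.
  rewrite subr_eq0 eq_sym -(prim_order_dvd prz).
  have lt_nf : (n < f)%N.
    rewrite -[X in (_ < X)%N]fE ltn_Pmull // (leq_trans (prime_gt1 q_pr)) //.
    by rewrite dvdn_leq // part_gt0.
  by apply/negP => /(dvdn_leq n_gt0); rewrite leqNgt lt_nf.
have q_lam : Zcong z lam q%:R 0.
  have prv : q.-primitive_root (z ^+ (f %/ q)) by apply: dvdn_prim_root.
  have s0 : \sum_(i < q) (z ^+ (f %/ q)) ^+ i = 0.
    have /eqP := subrX1 (z ^+ (f %/ q)) q.
    rewrite (prim_expr_order prv) subrr eq_sym mulf_eq0 subr_eq0 => /orP[|/eqP //].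
    rewrite -[_ ^+ _ == 1]/(_ ^+ 1 == 1) -(prim_order_dvd prv) dvdn1 => /eqP q1.
    by rewrite q1 in q_pr.
  rewrite -s0 -[q in q%:R]card_ord -sumr_const.
  elim/big_rec2: _ => [|i a b _ IH]; first exact: Zcong_refl.
  apply: ZcongD => //; apply: Zcong_sym.
  have -> : (f %/ q = n * (f`_q %/ q))%N by rewrite muln_divA // [(n * _)%N]mulnC fE.
  by rewrite exprM -exprM; apply: wX.
(* q ^ totient n is 1 modulo n, so z ^+ (q ^ totient n - 1) is a power of w. *)
have q_fix : Zcong z lam (z ^+ (q ^ totient n)%N) z.
  have qn : coprime q n by rewrite (@pnat_coprime q) ?pnat_id ?part_pnat.
  have /eqP := Euler_exp_totient qn.
  rewrite eqn_mod_dvd ?expn_gt0 ?prime_gt0 // => /dvdnP[j Dj].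
  rewrite -[(q ^ _)%N](@subnK 1) ?expn_gt0 ?prime_gt0 // Dj exprD expr1 mulnC exprM.
  rewrite -[Z in Zcong _ _ _ Z]mul1r; apply: ZcongM (wX j) (Zcong_refl _ _ _).
    exact: ZadjoinX.
  exact: Zadjoin_gen.
have [a Aa qlam] : Zcong z q%:R (lam ^+ f`_q%N) 0.
  have qq : Zcong z q%:R q%:R 0.
    by exists 1; [exact: (Zadjoin_nat _ 1) | rewrite subr0 mulr1].
  have := Zcong_exprD q_pr qq (logn q f) Alam Aw.
  rewrite -p_part subrK expr1n -exprM mulnC fE (prim_expr_order prz) => e.
  have := ZcongD (Zcong_sym e) (Zcong_refl z q%:R (-1)).
  by rewrite addrK subrr.
rewrite subr0 in qlam.
have : A (lam ^+ f`_q%N * x) by rewrite qlam mulrAC; apply: ZadjoinM.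
elim: (f`_q)%N => [|j IHj]; first by rewrite expr0 mul1r.
rewrite exprS -mulrA => Al; apply: IHj.
apply: (Zadjoin_divl q_pr q_lam q_fix) Al => //; first by rewrite totient_gt0.
by apply: integral_mul => //; apply/Zadjoin_integral/ZadjoinX.
Qed.

(** Some multiple [N%:R * x] with [N > 0] lies in [A]; the prime factors of [N] are
    removed one by one. *)
Lemma cyclotomic_integers x : x \in <<1; z>>%VS -> integral x -> A x.
Proof.
move=> /Fadjoin1_polyP[g Dx] intx.
have [N N_gt0 ANx] : exists2 N : nat, (0 < N)%N & A (N%:R * x).
  have [h [a a0 Dg]] := rat_poly_scale g.
  have Aax : A (a%:~R * x).
    exists h; rewrite Dx Dg map_polyZ hornerZ /= -map_poly_comp mulrA.
    have -> : a%:~R * (a%:~R^-1)%:A = 1 :> E.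
      rewrite -(rmorph_int (in_alg E)) -rmorphM /= divff ?rmorph1 ?intr_eq0 //.
      by rewrite scale1r.
    rewrite mul1r; congr (_.[z]); apply: eq_map_poly => b /=.
    by rewrite -[LHS]/(in_alg E b%:~R) rmorph_int.
  case: a a0 Aax {Dg} => n n0 An; first by exists n; rewrite // lt0n.
  exists n.+1 => //; move: An; rewrite NegzE mulrNz mulNr => /ZadjoinN.
  by rewrite opprK.
elim/ltn_ind: N N_gt0 x intx ANx {g Dx} => N IHN N_gt0 x intx ANx.
have [N1 | N_gt1] := leqP N 1.
  have N_1 : N = 1%N by apply/eqP; rewrite eqn_leq N1.
  by rewrite N_1 mul1r in ANx.
pose q := pdiv N; have q_pr : prime q := pdiv_prime N_gt1.
have DN : (q * (N %/ q))%N = N by rewrite mulnC divnK ?pdiv_dvd.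
apply: (IHN (N %/ q)%N) => //.
- by rewrite ltn_Pdiv ?prime_gt1.
- by rewrite divn_gt0 ?prime_gt0 // dvdn_leq ?pdiv_dvd.
have int' : integral ((N %/ q)%:R * x).
  by apply: integral_mul => //; apply: integral_nat.
have Aq : A (q%:R * ((N %/ q)%:R * x)) by rewrite mulrA -natrM DN.
have [qf | qNf] := boolP (q %| f)%N; first exact: (Zadjoin_divl_dvd q_pr qf).
by apply: (Zadjoin_divl_coprime q_pr _ int' Aq); rewrite prime_coprime.
Qed.

End CyclotomicIntegers.

(** * Radicals, and components of roots of unity *)

Lemma prod_primes_gt0 (s : seq nat) : all prime s -> (0 < \prod_(p <- s) p)%N.
Proof.
elim: s => [|p s IHs] /=; first by rewrite big_nil.
by move=> /andP[p_pr /IHs s_gt0]; rewrite big_cons muln_gt0 prime_gt0.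
Qed.

Lemma logn_prod_primes (s : seq nat) p : all prime s -> uniq s -> prime p ->
  logn p (\prod_(q <- s) q)%N = (p \in s).
Proof.
move=> + + p_pr; elim: s => [|q s IHs] /=; first by rewrite big_nil logn1.
move=> /andP[q_pr s_pr] /andP[q_s s_uniq].
rewrite big_cons (lognM _ (prime_gt0 q_pr) (prod_primes_gt0 s_pr)).
rewrite IHs // inE logn_prime //; case: eqP => [->|//].
by rewrite (negPf q_s).
Qed.

Section SquareFree.

Variable s : seq nat.
Hypotheses (s_pr : all prime s) (s_uniq : uniq s).
Local Notation m := (\prod_(p <- s) p)%N.

Lemma dvdn_prod_primes n : (0 < n)%N ->
  (m %| n)%N = all (fun p => p %| n)%N s.
Proof.
move=> n_gt0; apply/idP/allP => [mn p ps | sn].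
  apply: dvdn_trans mn; have p_pr := allP s_pr p ps.
  rewrite -[p]expn1 pfactor_dvdn ?prod_primes_gt0 //.
  by rewrite logn_prod_primes // ps.
apply/dvdn_partP; first exact: prod_primes_gt0.
move=> p; rewrite mem_primes => /and3P[p_pr _ pm].
rewrite p_part logn_prod_primes // pfactor_dvdn //; case: (boolP (p \in s)) => // ps.
by rewrite -pfactor_dvdn // expn1 sn.
Qed.

Lemma prime_dvd_prod_primes p : prime p -> (p %| m)%N = (p \in s).
Proof.
move=> p_pr; rewrite -{1}[p]expn1 pfactor_dvdn ?prod_primes_gt0 //.
by rewrite logn_prod_primes //; case: (p \in s).
Qed.

End SquareFree.

Definition rad (n : nat) : nat := (\prod_(p <- primes n) p)%N.

Lemma all_prime_primes n : all prime (primes n).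
Proof. by apply/allP => p; rewrite mem_primes => /andP[]. Qed.

Lemma rad_gt0 n : (0 < rad n)%N.
Proof. exact/prod_primes_gt0/all_prime_primes. Qed.

Lemma prime_dvd_rad p n : prime p -> (p %| rad n)%N = (p \in primes n).
Proof. exact/prime_dvd_prod_primes/primes_uniq/all_prime_primes. Qed.

Lemma rad_dvd n m : (0 < m)%N ->
  (forall p, p \in primes n -> (p %| m)%N) -> (rad n %| m)%N.
Proof.
move=> m_gt0 nm; rewrite dvdn_prod_primes ?all_prime_primes ?primes_uniq //.
exact/allP.
Qed.

Lemma rad_dvdn n : (0 < n)%N -> (rad n %| n)%N.
Proof. by move=> n_gt0; apply: rad_dvd => // p; rewrite mem_primes => /and3P[]. Qed.

Lemma totient_rad n : (0 < n)%N -> totient n = (n %/ rad n * totient (rad n))%N.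
Proof.
move=> n_gt0.
have pr_rad : primes (rad n) = primes n.
  apply/eq_primes => p; rewrite !mem_primes rad_gt0 n_gt0 /=.
  case: (boolP (prime p)) => //= p_pr.
  by rewrite prime_dvd_rad // mem_primes p_pr n_gt0.
have log_rad p : p \in primes n -> logn p (rad n) = 1%N.
  move=> pn; rewrite logn_prod_primes ?all_prime_primes ?primes_uniq ?pn //.
  exact: (allP (all_prime_primes n)).
rewrite !totientE ?rad_gt0 // pr_rad.
have -> : (n %/ rad n = \prod_(p <- primes n) p ^ (logn p n).-1)%N.
  have e : (n = \prod_(p <- primes n) p ^ (logn p n).-1 * rad n)%N.
    rewrite {1}(prod_prime_decomp n_gt0) prime_decompE big_map /=.
    rewrite /rad -big_split /=; apply: eq_big_seq => p; rewrite -logn_gt0 => lp.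
    by rewrite -expnSr prednK.
  by rewrite {1}e mulnK ?rad_gt0.
rewrite -big_split /=; apply: eq_big_seq => p pn.
by rewrite log_rad //= muln1 mulnC.
Qed.

Section UnityExponents.

Variable E : fieldType.
Implicit Types x y v : E.

Lemma expr_dvd1 x a b : (a %| b)%N -> x ^+ a = 1 -> x ^+ b = 1.
Proof. by move=> /dvdnP[k ->] xa; rewrite mulnC exprM xa expr1n. Qed.

Lemma expr_gcd1 x a b : (0 < a)%N -> x ^+ a = 1 -> x ^+ b = 1 ->
  x ^+ gcdn a b = 1.
Proof.
move=> a_gt0 xa xb; have [s prs sa] := prim_order_exists a_gt0 xa.
by apply/eqP; rewrite -(prim_order_dvd prs) dvdn_gcd sa (prim_order_dvd prs) xb eqxx.
Qed.

(** The exponents [f`_p^'] have no common divisor, [p] running through the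
    primes dividing [f]: they give the projections of the group of [f]-th roots
    of unity to its primary components (up to automorphisms of these). *)
Lemma unity_component1 f x : (0 < f)%N -> x ^+ f = 1 ->
  (forall p, p \in primes f -> x ^+ (f`_p^')%N = 1) -> x = 1.
Proof.
move=> f_gt0 xf xp; have [s prs sf] := prim_order_exists f_gt0 xf.
have [s1|/pdivP[p p_pr ps]] := leqP s 1.
  have /eqP e : s == 1%N by rewrite eqn_leq s1 (prim_order_gt0 prs).
  by have := prim_expr_order prs; rewrite e.
have pf : p \in primes f by rewrite mem_primes p_pr f_gt0 (dvdn_trans ps sf).
have : (s %| f`_p^')%N by rewrite (prim_order_dvd prs) xp.
move/(dvdn_trans ps); have := part_pnat p^' f; rewrite p'natE ?part_gt0 //.
by move=> /negPf ->.
Qed.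

End UnityExponents.

(** * Full roots of unity and their blocks *)

(** The power with exponent the [p']-part of [n] is, up to an automorphism, the
    projection to the [p]-component of the group of [n]-th roots of unity: the
    [n]-th root [y] is full if all primes dividing [n] divide its order. *)
Definition full (E : nzRingType) (n : nat) (y : E) : bool :=
  all (fun p : nat => y ^+ (n`_p^')%N != 1) (primes n).

(** For [y] of order dividing [n] this is the product of the primes whose square
    divides the order of [y]. *)
Definition wild_part (E : nzRingType) (n : nat) (y : E) : nat :=
  (\prod_(p <- [seq p : nat <- primes n | (y ^+ (p * n`_p^') != 1)%R]) p)%N.

Definition block (E : unitRingType) (n : nat) (y y' : E) : bool :=
  (y' / y) ^+ wild_part n y == 1.

Definition unity_roots (E : nzRingType) (n : nat) (z : E) : seq E :=
  [seq z ^+ i | i <- iota 0 n].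

Section Blocks.

Variables (E : fieldType) (f : nat) (z : E).
Hypothesis prz : f.-primitive_root z.
Let f_gt0 : (0 < f)%N := prim_order_gt0 prz.
Local Notation mu := (unity_roots f z).
Local Notation wild := (wild_part f).
Local Notation block := (block f).
Implicit Types x y v w : E.

Lemma mem_unity_roots x : (x \in mu) = (x ^+ f == 1).
Proof.
apply/mapP/eqP => [[i _ ->] | /(prim_rootP prz)[i ->]].
  by rewrite exprAC (prim_expr_order prz) expr1n.
by exists (i : nat); rewrite ?mem_iota /= ?ltn_ord.
Qed.

Lemma uniq_unity_roots : uniq mu.
Proof.
rewrite map_inj_in_uniq ?iota_uniq // => i j; rewrite !mem_iota /= => fi fj.
by move/eqP; rewrite (eq_prim_root_expr prz) !modn_small // => /eqP.
Qed.

Lemma unity_root_neq0 y : y \in mu -> y != 0.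
Proof.
rewrite mem_unity_roots; apply: contraTneq => ->.
by rewrite expr0n (gtn_eqF f_gt0) eq_sym oner_eq0.
Qed.

Lemma unity_rootM x y : x \in mu -> y \in mu -> x * y \in mu.
Proof. by rewrite !mem_unity_roots exprMn => /eqP -> /eqP ->; rewrite mulr1. Qed.

Lemma unity_root_dvd n v : (n %| f)%N -> v ^+ n = 1 -> v \in mu.
Proof. by move=> nf vn; rewrite mem_unity_roots (expr_dvd1 nf vn). Qed.

Let wild_pr y : all prime [seq p : nat <- primes f | y ^+ (p * f`_p^')%N != 1].
Proof. by apply/allP => p; rewrite mem_filter mem_primes => /and3P[]. Qed.

Let wild_uniq y : uniq [seq p : nat <- primes f | y ^+ (p * f`_p^')%N != 1].
Proof. exact/filter_uniq/primes_uniq. Qed.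

Lemma wild_gt0 y : (0 < wild y)%N.
Proof. by rewrite /wild_part prod_primes_gt0. Qed.

Lemma prime_dvd_wild y p : prime p ->
  (p %| wild y)%N = (p \in primes f) && (y ^+ (p * f`_p^')%N != 1).
Proof.
by move=> p_pr; rewrite /wild_part prime_dvd_prod_primes // mem_filter andbC.
Qed.

Lemma logn_wild_le1 y p : prime p -> (logn p (wild y) <= 1)%N.
Proof. by move=> p_pr; rewrite /wild_part logn_prod_primes //; case: (_ \in _). Qed.

Lemma wild_dvd y n : (0 < n)%N ->
  (forall p, prime p -> (p %| wild y)%N -> (p %| n)%N) -> (wild y %| n)%N.
Proof.
move=> n_gt0 yn; rewrite /wild_part dvdn_prod_primes //; apply/allP => p.
rewrite mem_filter => /andP[yp pf]; have p_pr := allP (all_prime_primes f) p pf.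
by apply: yn; rewrite // prime_dvd_wild // pf yp.
Qed.

Lemma wild_dvd_rad y : (wild y %| rad f)%N.
Proof.
apply: wild_dvd => [|p p_pr]; first exact: rad_gt0.
by rewrite prime_dvd_wild // prime_dvd_rad // => /andP[].
Qed.

Lemma wild_dvdn y : (wild y %| f)%N.
Proof. exact: dvdn_trans (wild_dvd_rad y) (rad_dvdn f_gt0). Qed.

Lemma dvdn_compl p q : p \in primes f -> q \in primes f -> p != q ->
  (p %| f`_q^')%N.
Proof.
rewrite !mem_primes => /and3P[p_pr _ pf] /and3P[q_pr _ _] pq.
have := pf; rewrite -{1}(partnC q f_gt0) Euclid_dvdM // => /orP[|//].
by rewrite p_part (Euclid_dvdX _ _ p_pr) dvdn_prime2 // (negPf pq).
Qed.

Lemma rad_dvd_compl p : p \in primes f -> (rad f %| p * f`_p^')%N.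
Proof.
move=> pf; have p_pr := allP (all_prime_primes f) p pf.
apply: rad_dvd => [|q qf]; first by rewrite muln_gt0 prime_gt0 //= part_gt0.
by have [->|qp] := eqVneq q p; [apply: dvdn_mulr | apply/dvdn_mull/dvdn_compl].
Qed.

(** The radical of [f] divides all the exponents [p * f`_p^'] testing whether
    [p] divides [wild y]. *)
Lemma wildM y v : v ^+ rad f = 1 -> wild (y * v) = wild y.
Proof.
move=> vr; congr (\prod_(p <- _) p)%N; apply: eq_in_filter => p pf.
by rewrite exprMn (expr_dvd1 (rad_dvd_compl pf) vr) mulr1.
Qed.

Lemma wild_coprime_compl y p : p \in primes f -> ~~ (p %| wild y)%N ->
  (wild y %| f`_p^')%N.
Proof.
move=> pf py; apply: wild_dvd => [|q q_pr qy]; first exact: part_gt0.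
apply: dvdn_compl => //; last by apply: contraNneq py => <-.
by move: qy; rewrite prime_dvd_wild // => /andP[].
Qed.

Lemma block_wild y y' : y \in mu -> block y y' -> wild y' = wild y.
Proof.
move=> /unity_root_neq0 y0 /eqP yy'.
by rewrite -(divfK y0 y') mulrC wildM // (expr_dvd1 (wild_dvd_rad y) yy').
Qed.

Lemma block_refl y : y \in mu -> block y y.
Proof. by move=> /unity_root_neq0 y0; rewrite /block divff // expr1n. Qed.

Lemma block_mu y y' : y \in mu -> block y y' -> y' \in mu.
Proof.
move=> ymu /eqP yy'; rewrite -(divfK (unity_root_neq0 ymu) y').
by apply: unity_rootM => //; apply: unity_root_dvd yy'; apply: wild_dvdn.
Qed.

Lemma block_sym y y' : y \in mu -> block y y' -> block y' y.
Proof.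
move=> ymu yy'; have e := block_wild ymu yy'; rewrite /block e.
by rewrite -invf_div exprVn (eqP yy') invr1.
Qed.

Lemma block_trans y x w : y \in mu -> block y x -> block x w -> block y w.
Proof.
move=> ymu yx; have e := block_wild ymu yx; rewrite /block e => xw.
have x0 := unity_root_neq0 (block_mu ymu yx).
rewrite -[w / y](_ : (w / x) * (x / y) = _); last by rewrite mulrA divfK.
by rewrite exprMn (eqP xw) (eqP yx) mulr1.
Qed.

Lemma block_eq y y' : y \in mu -> block y y' -> block y =1 block y'.
Proof.
move=> ymu yy' w; have y'mu := block_mu ymu yy'.
apply/idP/idP; apply: block_trans => //; exact: block_sym.
Qed.

Lemma full_block y y' : y \in mu -> full f y -> block y y' -> full f y'.
Proof.
move=> ymu /allP fy yy'; apply/allP => p pf.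
have p_pr := allP (all_prime_primes f) p pf.
have e := block_wild ymu yy'.
have [py | py] := boolP (p %| wild y)%N.
  move: py; rewrite -e prime_dvd_wild // pf /=; apply: contraNneq => yp.
  by rewrite mulnC exprM yp expr1n.
rewrite -(divfK (unity_root_neq0 ymu) y') exprMn.
by rewrite (expr_dvd1 (wild_coprime_compl pf py) (eqP yy')) mul1r fy.
Qed.

(** The sum of all [p]-th roots of unity vanishes, so that a root with trivial
    [p]-component is minus the sum of [p - 1] roots with the same components
    elsewhere and a [p]-component of order [p]. This removes the primes missing
    in the order one after the other; [l] is a list containing them. *)
Lemma full_spans n (S : E -> Prop) : (n %| f)%N ->
    (forall x y, S x -> S y -> S (x + y)) -> (forall x, S x -> S (- x)) -> S 0 ->
    (forall y, y ^+ n = 1 -> full n y -> S y) ->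
  forall y, y ^+ n = 1 -> S y.
Proof.
move=> nf SD SN S0 Sfull.
have n_gt0 : (0 < n)%N := dvdn_gt0 f_gt0 nf.
suff main (l : seq nat) : {subset l <= primes n} -> forall y, y ^+ n = 1 ->
    (forall p, p \in primes n -> p \notin l -> y ^+ (n`_p^')%N != 1) -> S y.
  by move=> y yn; apply: (main (primes n) _ y yn) => [p|p ->].
elim: l => [|p l IHl] ln y yn yl.
  by apply: Sfull => //; apply/allP => p pn; apply: yl.
have pn : p \in primes n by apply: ln; rewrite mem_head.
have {}ln : {subset l <= primes n} by move=> q ql; apply: ln; rewrite inE ql orbT.
have [yp | yp] := eqVneq (y ^+ (n`_p^')%N) 1; last first.
  apply: IHl => // q qn ql; have [-> // | qp] := eqVneq q p.
  by apply: yl; rewrite // inE negb_or qp.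
have p_pr : prime p by apply: (allP (all_prime_primes n)).
have p_gt1 := prime_gt1 p_pr.
have dpn : (p %| n)%N by move: pn; rewrite mem_primes => /and3P[].
have dpf : (p %| f)%N := dvdn_trans dpn nf.
pose v := z ^+ (f %/ p); have prv : p.-primitive_root v by apply: dvdn_prim_root.
have [r Dp] : exists r, p = r.+1 by exists p.-1; rewrite prednK ?prime_gt0.
have -> : y = - \sum_(i < r) y * v ^+ i.+1.
  have /eqP := subrX1 v p.
  rewrite (prim_expr_order prv) subrr eq_sym mulf_eq0 subr_eq0 => /orP[|].
    rewrite -[v]expr1 -(prim_order_dvd prv) dvdn1 => /eqP p1.
    by rewrite p1 in p_pr.
  rewrite Dp big_ord_recl expr0 addr_eq0 => /eqP e.
  have {}e : 1 = - \sum_(i < r) v ^+ i.+1 := e.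
  by rewrite -mulr_sumr -mulrN -e mulr1.
apply: SN; apply: big_ind => // i _.
have vi (q : nat) : (q != p) -> q \in primes n -> (v ^+ i.+1) ^+ (n`_q^')%N = 1.
  move=> qp qn; apply: (@expr_dvd1 _ _ p); last first.
    by rewrite exprAC (prim_expr_order prv) expr1n.
  have := dpn; rewrite -{1}(partnC q n_gt0) Euclid_dvdM // => /orP[|//].
  have q_pr := allP (all_prime_primes n) q qn.
  rewrite p_part Euclid_dvdX // dvdn_prime2 // => /andP[/eqP pq].
  by rewrite pq eqxx in qp.
apply: IHl => //.
  rewrite exprMn yn mul1r; apply: (@expr_dvd1 _ _ p) => //.
  by rewrite exprAC (prim_expr_order prv) expr1n.
move=> q qn ql; have [->{q qn ql} | qp] := eqVneq q p.
  rewrite exprMn yp mul1r -exprM -(prim_order_dvd prv) Gauss_dvdl.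
    by rewrite gtnNdvd // Dp ltnS ltn_ord.
  by rewrite (@pnat_coprime p) ?pnat_id ?part_pnat.
by rewrite exprMn vi // mulr1 yl // inE negb_or qp.
Qed.

Lemma wild_sqr y s p : y ^+ f = 1 -> s.-primitive_root y -> prime p ->
  (p %| wild y)%N -> (p ^ 2 %| s)%N.
Proof.
move=> yf prs p_pr; rewrite prime_dvd_wild // => /andP[pf]; apply: contraR => ps.
have s_gt0 := prim_order_gt0 prs.
have sf : (s %| f)%N by rewrite (prim_order_dvd prs) yf.
rewrite -(prim_order_dvd prs) -(partnC p s_gt0) dvdn_mul ?partn_dvd //.
move: ps; rewrite pfactor_dvdn // -ltnNge ltnS p_part => lp.
by rewrite -[X in (_ %| X)%N]expn1 dvdn_exp2l.
Qed.

(** If [y ^+ a] lies in the block of [y], then the order of [y] divides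
    [(a - 1) * wild y]. For [p %| wild y] the square of [p] divides this order
    while [p] divides [wild y] only once, so that [p %| a - 1]. Hence
    [wild y %| a - 1]: raising to the power [a] multiplies all elements of the
    block by the same root of unity [y ^+ a / y]. *)
Lemma block_scalar y a v : y \in mu -> (0 < a)%N -> block y (y ^+ a) ->
  v ^+ wild y = 1 -> v ^+ a = v.
Proof.
case: a => // a ymu _; have y0 := unity_root_neq0 ymu.
rewrite /block exprSr mulfK // -exprM => /eqP yam vm.
have yf : y ^+ f = 1 by apply/eqP; rewrite -mem_unity_roots.
rewrite exprSr; suff /(expr_dvd1) -> : (wild y %| a)%N by rewrite ?mul1r.
have [-> | a_gt0] := posnP a; first exact: dvdn0.
apply: wild_dvd => // p p_pr py.
have [s prs _] := prim_order_exists f_gt0 yf.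
apply: contraT => pa; have p2a : (p ^ 2 %| a * wild y)%N.
  by apply: dvdn_trans (wild_sqr yf prs p_pr py) _; rewrite (prim_order_dvd prs) yam.
move: p2a.
have a_p : logn p a = 0%N by rewrite logn_coprime ?prime_coprime.
rewrite pfactor_dvdn ?muln_gt0 ?a_gt0 ?wild_gt0 // lognM ?wild_gt0 // a_p.
by rewrite add0n leqNgt ltnS logn_wild_le1.
Qed.

Lemma count_full : (forall p, (logn p f <= 1)%N) ->
  (count (full f) mu <= totient f)%N.
Proof.
move=> sqf; rewrite totient_count_coprime /index_iota subn0.
have -> : (\sum_(d <- iota 0 f) coprime f d = count (coprime f) (iota 0 f))%N.
  by rewrite -sum1_count [RHS]big_mkcond; apply: eq_bigr => d _; case: coprime.
rewrite count_map; apply: sub_count => i /= /allP fi.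
rewrite -[coprime f i]negbK; apply/negP.
rewrite /coprime neq_ltn ltnNge gcdn_gt0 f_gt0 /= => /pdivP[p p_pr].
rewrite dvdn_gcd => /andP[pf pi]; have pf' : p \in primes f.
  by rewrite mem_primes p_pr f_gt0.
have := fi p pf'; rewrite -exprM -(prim_order_dvd prz) -{1}(partnC p f_gt0).
rewrite dvdn_mul // p_part; apply: dvdn_trans pi.
by rewrite -[X in (_ %| X)%N]expn1 dvdn_exp2l.
Qed.

Section BasePoints.

Variable beta : E -> E.
Hypothesis beta_block : forall y, y \in mu -> block y (beta y).
Hypothesis beta_const : forall y y', y \in mu -> block y y' -> beta y' = beta y.

(** With [m = wild w], the full [m]-th roots of unity are the primitive ones, and
    they form a basis of the ring that they generate, since [m] is squarefree.
    So the based roots in a block form a basis of its span. *)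
Definition based w : bool := full f w && full (wild w) (w / beta w).
Local Notation W := [seq w <- mu | based w].

Lemma based_spans (S : E -> Prop) y :
    (forall x x', S x -> S x' -> S (x + x')) -> (forall x, S x -> S (- x)) ->
    S 0 -> (forall w, w \in W -> block y w -> S w) ->
  y \in mu -> full f y -> S y.
Proof.
move=> SD SN S0 SW ymu fy; have yb := beta_block ymu.
have bmu := block_mu ymu yb; have b0 := unity_root_neq0 bmu.
rewrite -(divfK b0 y).
have nf := wild_dvdn y.
apply: (@full_spans _ (fun v => S (v * beta y)) nf) => //.
- by move=> x x'; rewrite mulrDl; apply: SD.
- by move=> x; rewrite mulNr; apply: SN.
- by rewrite mul0r.
- move=> v vn fv; pose w := v * beta y.
  have bw : block (beta y) w by rewrite /block (block_wild ymu yb) mulfK // vn.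
  have yw : block y w := block_trans ymu yb bw.
  apply: SW => //; rewrite mem_filter (block_mu ymu yw) andbT /based.
  rewrite (full_block ymu fy yw) (block_wild ymu yw) (beta_const ymu yw).
  by rewrite mulfK.
have := block_sym ymu yb; rewrite /block (block_wild ymu yb) => /eqP; done.
Qed.

End BasePoints.
End Blocks.

(** Let [r] be the radical of [f], and [w] a based root with [m = wild w]. The
    power [w ^+ m ^ f] has order [r %/ m]: it is trivial at the primes dividing
    [m], and [w] has order [p] at the other ones. So its product with the
    primitive [m]-th root [w / beta w] is a primitive [r]-th root of unity. This
    product and [w ^+ r] determine [w], and the pairs of an [f %/ r]-th root and
    a primitive [r]-th root of unity are [totient f] in number. *)
Lemma size_based (E : fieldType) (f : nat) (z : E) (beta : E -> E) :
    f.-primitive_root z -> let mu := unity_roots f z in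
    (forall y, y \in mu -> block f y (beta y)) ->
    (forall y y', y \in mu -> block f y y' -> beta y' = beta y) ->
  (size [seq w <- mu | based f beta w] <= totient f)%N.
Proof.
move=> prz mu beta_block beta_const; have f_gt0 := prim_order_gt0 prz.
set W := filter _ _; pose r := rad f; pose e (w : E) := (wild_part f w ^ f)%N.
have r_gt0 : (0 < r)%N := rad_gt0 f.
have rf : (r %| f)%N := rad_dvdn f_gt0.
have qf : (f %/ r %| f)%N by rewrite -{2}(divnK rf) dvdn_mulr.
have logr (p : nat) : p \in primes f -> logn p r = 1%N.
  move=> pf; rewrite logn_prod_primes ?all_prime_primes ?primes_uniq ?pf //.
  exact: (allP (all_prime_primes f)).
have prq := dvdn_prim_root prz qf; have prr := dvdn_prim_root prz rf.
pose psi (w : E) := (w ^+ r, w ^+ e w * (w / beta w)).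
pose Q := unity_roots (f %/ r) (z ^+ (f %/ (f %/ r))).
pose P := [seq u <- unity_roots r (z ^+ (f %/ r)) | full r u].
rewrite (totient_rad f_gt0) -(size_map psi).
apply: (@leq_trans (size [seq (x, y) | x <- Q, y <- P])); last first.
  rewrite size_allpairs size_map size_iota leq_mul2l size_filter.
  rewrite (count_full prr) ?orbT // => p.
  have [p_pr | /negPf pN] := boolP (prime p); last by rewrite lognE pN.
  rewrite logn_prod_primes ?all_prime_primes ?primes_uniq //.
  by case: (_ \in _).
have WP (w : E) : w \in W -> [/\ w \in mu, full f w, full (wild_part f w) (w / beta w)
    & (w / beta w) ^+ wild_part f w = 1].
  rewrite mem_filter => /andP[/andP[fw fv] wmu]; split=> //.
  have bw := block_sym prz wmu (beta_block w wmu).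
  by move: bw; rewrite /block (block_wild prz wmu (beta_block w wmu)) => /eqP.
have dvd_e (w : E) (p : nat) : p \in primes f -> (p %| wild_part f w)%N ->
    (f %| e w * f`_p^')%N.
  move=> pf pw; rewrite -{1}(partnC p f_gt0) dvdn_mul // p_part.
  apply: (@dvdn_trans (p ^ f)%N); last by rewrite dvdn_exp2r.
  by rewrite dvdn_exp2l // ltnW // ltn_logl.
(* The order of w ^+ e w is the product of the primes that divide f but not
   wild_part f w. *)
have kill (w : E) (c : nat) : w \in mu ->
    (forall p : nat, p \in primes f -> ~~ (p %| wild_part f w)%N -> (p %| c)%N) ->
    w ^+ (e w * c) = 1.
  move=> wmu wc; have wf : w ^+ f = 1 by apply/eqP; rewrite -(mem_unity_roots prz).
  apply: (unity_component1 f_gt0) => [|p pf].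
    by rewrite exprAC wf expr1n.
  have p_pr := allP (all_prime_primes f) p pf.
  rewrite -exprM; have [pw|pw] := boolP (p %| wild_part f w)%N.
    by apply: expr_dvd1 wf; rewrite mulnAC dvdn_mulr ?dvd_e.
  apply: (@expr_dvd1 _ _ (p * f`_p^')%N); first by rewrite dvdn_mul // dvdn_mull ?wc.
  by move: pw; rewrite prime_dvd_wild // pf /= negbK => /eqP.
apply: uniq_leq_size.
  rewrite map_inj_in_uniq ?filter_uniq ?uniq_unity_roots //.
  move=> w1 w2 /WP[w1mu _ _ v1m] /WP[w2mu _ _ v2m] [wr wu].
  have w20 := unity_root_neq0 prz w2mu.
  pose d := w1 / w2; have dr : d ^+ r = 1.
    by rewrite exprMn exprVn wr divff // expf_neq0.
  have D1 : w1 = w2 * d by rewrite mulrC divfK.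
  have m12 : wild_part f w1 = wild_part f w2 by rewrite D1 (wildM prz).
  pose m := wild_part f w2; have m_gt0 : (0 < m)%N := wild_gt0 f w2.
  have mr : (m %| r)%N := wild_dvd_rad f w2.
  rewrite m12 -/m in v1m; rewrite -/m in v2m.
  have de : d ^+ e w2 * (w1 / beta w1) = w2 / beta w2.
    apply: (mulfI (expf_neq0 (e w2) w20)); rewrite -wu /e m12 -/m.
    by rewrite [LHS]mulrA -exprMn -D1.
  (* The greatest common divisor of the exponents r and e w2 * m is m. *)
  have dm : d ^+ m = 1.
    have dem : d ^+ (e w2 * m) = 1.
      have := congr1 (fun x => x ^+ m) de.
      by rewrite exprMn v1m mulr1 v2m -exprM.
    have := expr_gcd1 r_gt0 dr dem; rewrite -(divnK mr) -muln_gcdl.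
    suff /eqP -> : coprime (r %/ m) (e w2) by rewrite mul1n.
    rewrite coprimeXr //; rewrite -[coprime _ _]negbK; apply/negP.
    rewrite /coprime neq_ltn ltnNge gcdn_gt0 m_gt0 orbT /= => /pdivP[p p_pr].
    rewrite dvdn_gcd => /andP[pr pm].
    have pf : p \in primes f.
      by rewrite -prime_dvd_rad //; apply: dvdn_trans pm mr.
    have rm_gt0 : (0 < r %/ m)%N by rewrite divn_gt0 // dvdn_leq.
    have := logr p pf; rewrite -(divnK mr) lognM //.
    have : (0 < logn p (r %/ m))%N by rewrite logn_gt0 mem_primes p_pr rm_gt0.
    have : (0 < logn p m)%N by rewrite logn_gt0 mem_primes p_pr m_gt0.
    by case: (logn p m) (logn p (r %/ m)) => [|i] // [|j] //; rewrite addnS.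
  have bl : block f w2 w1 by rewrite /block dm.
  have de1 : d ^+ e w2 = 1 by apply: expr_dvd1 dm; rewrite dvdn_exp.
  move: de; rewrite de1 mul1r (beta_const _ _ w2mu bl) => /mulIf -> //.
  have bmu := block_mu prz w2mu (beta_block _ w2mu).
  by rewrite invr_neq0 // (unity_root_neq0 prz bmu).
move=> _ /mapP[w /WP[wmu fw fv vm] ->]; rewrite allpairs_f //.
  rewrite mem_unity_roots // -exprM mulnC divnK //.
  by rewrite -(mem_unity_roots prz).
set v := w / beta w in fv vm *; set m := wild_part f w in fv vm *.
have mr : (m %| r)%N := wild_dvd_rad f w.
rewrite mem_filter mem_unity_roots // exprMn (expr_dvd1 mr vm) -exprM.
rewrite kill ?mulr1 ?eqxx ?andbT //; last first.
  by move=> p pf _; rewrite prime_dvd_rad ?(allP (all_prime_primes f) p pf).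
apply/allP => p; rewrite mem_primes => /and3P[p_pr _ pr].
have pf : p \in primes f by rewrite -prime_dvd_rad.
pose c := (r`_p^')%N; have rE : r = (p * c)%N.
  by rewrite -{1}(partnC p r_gt0) p_part logr.
have pc : coprime p c by rewrite (@pnat_coprime p) ?pnat_id ?part_pnat.
rewrite -/c; apply/negP => /eqP uc; have [pm | pm] := boolP (p %| m)%N.
  have wec : w ^+ (e w * c) = 1.
    apply: kill => // q qf' qm; have q_pr := allP (all_prime_primes f) q qf'.
    have : (q %| p * c)%N by rewrite -rE prime_dvd_rad.
    rewrite Euclid_dvdM // dvdn_prime2 // => /orP[/eqP qp|//].
    by rewrite -qp -/m (negPf qm) in pm.
  have vc : v ^+ c = 1 by move: uc; rewrite exprMn -exprM wec mul1r.
  have m_gt0 : (0 < m)%N := wild_gt0 f w.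
  have pm' : p \in primes m by rewrite mem_primes p_pr m_gt0.
  have /eqP[] := allP fv p pm'.
  apply: expr_dvd1 (expr_gcd1 m_gt0 vm vc).
  have: (gcdn m c %| m`_p * m`_p^')%N by rewrite partnC // dvdn_gcdl.
  rewrite Gauss_dvdr // coprime_sym p_part coprimeXl //.
  by apply: coprime_dvdr pc; apply: dvdn_gcdr.
have vc : v ^+ c = 1.
  apply: expr_dvd1 vm; have : (m %| p * c)%N by rewrite -rE.
  by rewrite Gauss_dvdr // coprime_sym prime_coprime.
have wec : w ^+ (e w * c) = 1 by move: uc; rewrite exprMn -exprM vc mulr1.
have wp : w ^+ (f`_p^' * p) = 1.
  by move: pm; rewrite prime_dvd_wild // pf /= negbK mulnC => /eqP.
have n_gt0 : (0 < f`_p^' * p)%N by rewrite muln_gt0 part_gt0 prime_gt0.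
have := expr_gcd1 n_gt0 wp (expr_dvd1 (dvdn_mull (f`_p^')%N (dvdnn (e w * c))) wec).
rewrite -muln_gcdr; suff /eqP -> : coprime p (e w * c).
  by rewrite muln1; apply/eqP/(allP fw).
by rewrite coprimeMr pc andbT coprimeXr // prime_coprime.
Qed.

(** * A basis of the cyclotomic integers adapted to the blocks *)

Definition Zspan (V : zmodType) (s : seq V) (x : V) : Prop :=
  exists c : V -> int, x = \sum_(w <- s) w *~ c w.

Section Zspan.

Variables (V : zmodType) (s : seq V).

Lemma Zspan0 : Zspan s 0.
Proof. by exists (fun=> 0); rewrite big1. Qed.

Lemma ZspanD x y : Zspan s x -> Zspan s y -> Zspan s (x + y).
Proof.
move=> [c ->] [d ->]; exists (fun w => c w + d w).
by rewrite -big_split; apply: eq_bigr => w _; rewrite mulrzDr.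
Qed.

Lemma ZspanN x : Zspan s x -> Zspan s (- x).
Proof.
move=> [c ->]; exists (fun w => - c w).
by rewrite -sumrN; apply: eq_bigr => w _; rewrite mulrNz.
Qed.

Lemma ZspanMz x n : Zspan s x -> Zspan s (x *~ n).
Proof.
move=> [c ->]; exists (fun w => c w * n).
by rewrite mulrz_suml; apply: eq_bigr => w _; rewrite mulrzA.
Qed.

Lemma Zspan_mem w : uniq s -> w \in s -> Zspan s w.
Proof.
move=> us ws; exists (fun v => (v == w)%:Z).
rewrite (bigD1_seq w) //= eqxx mulr1z big1 ?addr0 // => v /negPf ->.
by rewrite mulr0z.
Qed.

End Zspan.

(** For a free family [s] this is, on the span of [s], the projection onto the
    span of the members in [B] along the others. *)
Definition partial_sum (E : vectType rat) (s : seq E) (B : pred E) (x : E) : E :=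
  \sum_(i < size s | B s`_i) coord (in_tuple s) i x *: s`_i.

Fact partial_sum_linear E s B : linear (@partial_sum E s B).
Proof.
move=> a x y; rewrite /partial_sum scaler_sumr -big_split; apply: eq_bigr => i _.
by rewrite linearP scalerDl scalerA.
Qed.

HB.instance Definition _ (E : vectType rat) (s : seq E) (B : pred E) :=
  GRing.isLinear.Build rat E E *:%R (@partial_sum E s B) (partial_sum_linear s B).

Lemma partial_sum_mem (E : vectType rat) (s : seq E) (B : pred E) (w : E) :
  free s -> w \in s -> partial_sum s B w = if B w then w else 0.
Proof.
move=> fs /(nthP 0)[j js <-]; rewrite /partial_sum big_mkcond /=.
have cj (i : 'I_(size s)) : coord (in_tuple s) i s`_j = (i == Ordinal js)%:R.
  by rewrite eq_sym; apply: (coord_free (Ordinal js) i (fs : free (in_tuple s))).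
rewrite (bigD1 (Ordinal js)) //= big1 ?addr0 => [|i]; last first.
  by move=> /negPf ij; rewrite cj ij scale0r if_same.
by rewrite cj eqxx scale1r.
Qed.

Lemma free_Zindep (E : vectType rat) (s : seq E) (c : E -> int) :
  free s -> \sum_(w <- s) w *~ c w = 0 -> {in s, forall w, c w = 0}.
Proof.
move=> fs sc w ws; have w0 : w != 0 by apply: free_not0 fs ws.
have := congr1 (partial_sum s (pred1 w)) sc.
rewrite raddf_sum raddf0 (bigD1_seq w) ?free_uniq //= big_seq_cond big1.
  rewrite addr0 raddfMz /= partial_sum_mem //= eqxx -scaler_int => /eqP.
  by rewrite scaler_eq0 (negPf w0) orbF intr_eq0 => /eqP.
move=> v /andP[vs vw]; rewrite raddfMz /= partial_sum_mem //= (negPf vw).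
by rewrite mul0rz.
Qed.

Section CyclotomicBasis.

Variables (E : fieldExtType rat) (f : nat) (z : E).
Hypothesis prz : f.-primitive_root z.
Local Notation mu := (unity_roots f z).

Variable beta : E -> E.
Hypothesis beta_block : forall y, y \in mu -> block f y (beta y).
Hypothesis beta_const :
  forall y y', y \in mu -> block f y y' -> beta y' = beta y.

Local Notation W := [seq w <- mu | based f beta w].

Let W_uniq : uniq W.
Proof. exact/filter_uniq/(uniq_unity_roots prz). Qed.

Lemma based_Zspan_block y : y \in mu -> full f y ->
  Zspan [seq w <- W | block f y w] y.
Proof.
move=> ymu fy; apply: (based_spans prz beta_block beta_const) ymu fy.
- exact: ZspanD.
- exact: ZspanN.
- exact: Zspan0.
move=> w ws yw; apply: Zspan_mem; first exact/filter_uniq/W_uniq.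
by rewrite mem_filter yw.
Qed.

Lemma based_Zspan y : y \in mu -> Zspan W y.
Proof.
rewrite (mem_unity_roots prz) => /eqP.
apply: (full_spans prz (dvdnn f)); [exact: ZspanD | exact: ZspanN | exact: Zspan0 |].
move=> x /eqP; rewrite -(mem_unity_roots prz) => xmu fx.
apply: (based_spans prz beta_block beta_const) xmu fx.
- exact: ZspanD.
- exact: ZspanN.
- exact: Zspan0.
by move=> w ws _; apply: Zspan_mem.
Qed.

Let zX_mu i : z ^+ i \in mu.
Proof. by rewrite (mem_unity_roots prz) exprAC (prim_expr_order prz) expr1n. Qed.

Lemma Zadjoin_Zspan x : Zadjoin z x -> Zspan W x.
Proof.
case=> p ->; rewrite horner_coef; apply: big_ind.
- exact: Zspan0.
- by move=> ? ?; apply: ZspanD.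
move=> i _; rewrite coef_map /= mulrzl; exact/ZspanMz/based_Zspan/zX_mu.
Qed.

(** The based roots span [Q(z)], and they are not more than its dimension. *)
Lemma based_free : free W.
Proof.
rewrite /free eqn_leq dim_span /=.
apply: leq_trans (size_based prz beta_block beta_const) _.
apply: leq_trans (dim_cyclotomic_ge prz) _; apply: dimvS.
apply/subvP => _ /Fadjoin1_polyP[p ->]; rewrite horner_coef; apply: rpred_sum => i _.
rewrite coef_map /= -scalerAl mul1r; apply: rpredZ.
have [c ->] := based_Zspan (zX_mu i); rewrite big_seq; apply: rpred_sum => w ws.
by rewrite -scaler_int rpredZ // memv_span.
Qed.

(** Each full root is a combination of the based roots in its own block, and the
    based roots are free. So the spaces spanned by the blocks are independent. *)
Lemma block_direct (a : E -> int) b : b \in mu ->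
    \sum_(y <- mu | full f y) y *~ a y = 0 ->
  \sum_(y <- mu | full f y && block f b y) y *~ a y = 0.
Proof.
move=> bmu /(congr1 (partial_sum W (block f b))); rewrite raddf0 raddf_sum => e.
rewrite -[RHS]e big_mkcondr /= big_seq_cond [RHS]big_seq_cond.
apply: eq_bigr => y /andP[ymu fy]; rewrite raddfMz /=.
suff -> : partial_sum W (block f b) y = if block f b y then y else 0.
  by case: ifP; rewrite ?mul0rz.
have [c Dy] := based_Zspan_block ymu fy.
rewrite {1}Dy raddf_sum /=.
transitivity (\sum_(w <- [seq w <- W | block f y w])
   (if block f b y then w *~ c w else 0)); last first.
  by case: ifP; rewrite -?Dy // big1.
rewrite big_seq [RHS]big_seq; apply: eq_bigr => w; rewrite mem_filter => /andP[yw Ww].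
rewrite raddfMz /= partial_sum_mem ?based_free //.
have -> : block f b w = block f b y.
  apply/idP/idP => [bw | byy]; last exact: (block_trans prz bmu byy yw).
  exact: (block_trans prz bmu bw (block_sym prz ymu yw)).
by case: ifP; rewrite ?mul0rz.
Qed.

End CyclotomicBasis.

(** * The action of automorphisms on the blocks *)

Lemma head_filterP (T : eqType) (x0 x : T) (s : seq T) (P : pred T) :
  x \in s -> P x ->
  (head x0 [seq t <- s | P t] \in s) && P (head x0 [seq t <- s | P t]).
Proof.
move=> xs Px; set h := head _ _.
suff : h \in [seq t <- s | P t] by rewrite mem_filter andbC.
have : x \in [seq t <- s | P t] by rewrite mem_filter Px.
by rewrite /h; case: filter => //= a l _; rewrite mem_head.
Qed.

Section Automorphism.

Variables (E : fieldType) (f : nat) (z : E).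
Hypothesis prz : f.-primitive_root z.
Local Notation mu := (unity_roots f z).
Variable s : {rmorphism E -> E}.

Lemma rmorph_expr_eq1 y n : (s y ^+ n == 1) = (y ^+ n == 1).
Proof. by rewrite -rmorphXn fmorph_eq1. Qed.

Lemma rmorph_unity_roots y : (s y \in mu) = (y \in mu).
Proof. by rewrite !(mem_unity_roots prz) rmorph_expr_eq1. Qed.

Lemma rmorph_full n y : full n (s y) = full n y.
Proof. by apply: eq_all => p; rewrite rmorph_expr_eq1. Qed.

Lemma rmorph_wild y : wild_part f (s y) = wild_part f y.
Proof.
congr (\prod_(p <- _) p)%N; apply: eq_filter => p.
by rewrite rmorph_expr_eq1.
Qed.

Lemma rmorph_block y y' : block f (s y) (s y') = block f y y'.
Proof. by rewrite /block rmorph_wild -fmorph_div rmorph_expr_eq1. Qed.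

Lemma rmorph_unity_pow : exists2 a, (0 < a)%N & {in mu, forall y, s y = y ^+ a}.
Proof.
have f_gt0 := prim_order_gt0 prz.
have szf : s z ^+ f = 1 by rewrite -rmorphXn (prim_expr_order prz) rmorph1.
have [i sz] := prim_rootP prz szf; exists (i + f)%N.
  by rewrite addn_gt0 f_gt0 orbT.
move=> y ymu; have /eqP yf : y ^+ f == 1 by rewrite -(mem_unity_roots prz).
rewrite exprD yf mulr1; have [j ->] := prim_rootP prz yf.
by rewrite rmorphXn /= sz exprAC.
Qed.

Lemma rmorph_block_scalar y v :
  y \in mu -> block f y (s y) -> v ^+ wild_part f y = 1 -> s v = v.
Proof.
move=> ymu; have [a a_gt0 sa] := rmorph_unity_pow; rewrite sa // => bl vy.
have vmu : v \in mu.
  exact: (unity_root_dvd prz (wild_dvdn prz y) vy).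
by rewrite sa //; apply: (block_scalar prz) ymu a_gt0 bl vy.
Qed.

Lemma perm_unity_roots : perm_eq (map s mu) mu.
Proof.
have us : uniq (map s mu).
  by rewrite (map_inj_uniq (fmorph_inj s)) (uniq_unity_roots prz).
apply: (uniq_perm us (uniq_unity_roots prz)).
have sub : {subset map s mu <= mu}.
  by move=> _ /mapP[y ymu ->]; rewrite rmorph_unity_roots.
have sz : (size mu <= size (map s mu))%N by rewrite size_map.
exact: (uniq_min_size us sub sz).2.
Qed.

End Automorphism.

Section OrbitBasis.

Variables (E : splittingFieldType rat) (f : nat) (z : E).
Hypothesis prz : f.-primitive_root z.
Local Notation mu := (unity_roots f z).
Local Notation K := <<1; z>>%AS.
Variable H : {group gal_of K}.
Implicit Types (x y w t : E) (s : gal_of K).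

Lemma unity_root_adjoin y : y \in mu -> y \in <<1; z>>%VS.
Proof. by case/mapP => i _ ->; rewrite rpredX // memv_adjoin. Qed.

Definition orb y t : bool := t \in [seq s y | s : gal_of K in H].

Lemma orbP y t : reflect (exists2 s, s \in H & t = s y) (orb y t).
Proof. exact: imageP. Qed.

Lemma gal_unity_root s y : y \in mu -> s y \in mu.
Proof. by move=> ymu; rewrite (rmorph_unity_roots prz). Qed.

Lemma orb_refl y : orb y y.
Proof. by apply/orbP; exists 1%g; rewrite ?gal_id. Qed.

Lemma orb_trans y t w : y \in mu -> orb y t -> orb t w -> orb y w.
Proof.
move=> ymu /orbP[s sH ->] /orbP[s' s'H ->]; apply/orbP; exists (s * s')%g.
  exact: groupM.
by rewrite galM // unity_root_adjoin.
Qed.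

Lemma galVK s y : y \in mu -> (s^-1)%g (s y) = y.
Proof. by move=> ymu; rewrite -galM ?unity_root_adjoin // mulgV gal_id. Qed.

Lemma galKV s y : y \in mu -> s ((s^-1)%g y) = y.
Proof. by move=> ymu; rewrite -galM ?unity_root_adjoin // mulVg gal_id. Qed.

Lemma orb_sym y t : y \in mu -> orb y t -> orb t y.
Proof.
move=> ymu /orbP[s sH ->]; apply/orbP; exists (s^-1)%g; first exact: groupVr.
by rewrite galVK.
Qed.

(** Both [block_rep y] and [base_point y] are the first elements in [mu] with a
    property that depends only on the block of [y]; the default value [1] of
    [head] is never reached for [y \in mu]. The former represents the [H]-orbit
    of the block. Taking base points in the [H]-orbit of the representative makes
    them [H]-equivariant as soon as this orbit meets each block only once. *)
Definition block_rep y : E :=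
  head 1 [seq t <- mu | [exists s in H, block f y ((s : gal_of K) t)]].

Definition base_point y : E :=
  head 1 [seq t <- mu | block f y t && orb (block_rep y) t].

Lemma block_repP y : y \in mu ->
  (block_rep y \in mu) && [exists s in H, block f y ((s : gal_of K) (block_rep y))].
Proof.
move=> ymu; apply: (@head_filterP _ _ y) => //.
apply/exists_inP; exists 1%g; first exact: group1.
by rewrite gal_id (block_refl prz).
Qed.

Lemma base_pointP y : y \in mu ->
  (base_point y \in mu) &&
  (block f y (base_point y) && orb (block_rep y) (base_point y)).
Proof.
move=> ymu; have /andP[rmu /exists_inP[s sH ys]] := block_repP ymu.
apply: (@head_filterP _ _ (s (block_rep y))); first exact: gal_unity_root.
by rewrite ys; apply/orbP; exists s.
Qed.

Lemma base_point_block y : y \in mu -> block f y (base_point y).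
Proof. by case/base_pointP/and3P. Qed.

Lemma base_point_const y y' : y \in mu -> block f y y' -> base_point y' = base_point y.
Proof.
move=> ymu yy'; have e := block_eq prz ymu yy'.
have er : block_rep y' = block_rep y.
  congr (head _ _); apply: eq_filter => t; apply: eq_existsb => s.
  by rewrite e.
by congr (head _ _); apply: eq_filter => t; rewrite e er.
Qed.

(** By [gal_block_scalar] this is a property of the block of [y]: the
    automorphisms in [H] preserving the block fix all its elements. *)
Definition rigid y : bool :=
  [forall s in H, block f y ((s : gal_of K) y) ==> ((s : gal_of K) y == y)].

Lemma rigidP y :
  reflect {in H, forall s, block f y (s y) -> s y = y} (rigid y).
Proof.
apply: (iffP forall_inP) => [ty s sH ys|ty s sH].
  by apply/eqP; have /implyP := ty s sH; apply.
by apply/implyP => ys; rewrite ty.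
Qed.

Lemma gal_block_scalar s y v : y \in mu -> block f y (s y) ->
  v ^+ wild_part f y = 1 -> s v = v.
Proof. exact: rmorph_block_scalar. Qed.

Lemma gal_block s y y' : block f (s y) (s y') = block f y y'.
Proof. exact: rmorph_block. Qed.

Lemma rigid_block y y' : y \in mu -> block f y y' -> rigid y -> rigid y'.
Proof.
move=> ymu yy' /rigidP ty; apply/rigidP => s sH y's.
have y'mu := block_mu prz ymu yy'; have y0 := unity_root_neq0 prz ymu.
have ys : block f y (s y).
  apply: (block_trans prz ymu yy'); apply: (block_trans prz y'mu y's).
  by rewrite gal_block; exact: (block_sym prz ymu yy').
have v1 : s (y' / y) = y' / y.
  by apply: (gal_block_scalar ymu ys); apply/eqP.
by rewrite -(divfK y0 y') rmorphM /= v1 ty.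
Qed.

Lemma rigid_gal s y : y \in mu -> s \in H -> rigid y -> rigid (s y).
Proof.
move=> ymu sH /rigidP ty; apply/rigidP => t tH.
have symu := gal_unity_root s ymu.
have Ky := unity_root_adjoin ymu; have Ksy := unity_root_adjoin symu.
pose u := (s * t * s^-1)%g; have uH : u \in H by rewrite !groupM ?groupV.
have uy : u y = (s^-1)%g (t (s y)) by rewrite !galM // memv_gal // memv_gal.
have tE : t (s y) = s (u y) by rewrite uy galKV // !gal_unity_root.
by rewrite tE gal_block => /(ty u uH) ->.
Qed.

(** Both sides lie in the block of [s y] and in one [H]-orbit, and an orbit meets a
    rigid block in at most one point. *)
Lemma base_point_gal s y : y \in mu -> s \in H -> rigid y ->
  base_point (s y) = s (base_point y).
Proof.
move=> ymu sH ty; have symu := gal_unity_root s ymu.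
have /and3P[bmu yb rb] := base_pointP ymu.
have /and3P[b'mu syb' rb'] := base_pointP symu.
have /andP[rmu _] := block_repP ymu.
have er : block_rep (s y) = block_rep y.
  congr (head _ _); apply: eq_in_filter => t tmu; have Kt := unity_root_adjoin tmu.
  apply/exists_inP/exists_inP => [] [u uH bu].
    exists (u * s^-1)%g; first by rewrite groupM ?groupV.
    by rewrite galM // -(gal_block s) galKV // gal_unity_root.
  by exists (u * s)%g; rewrite ?groupM // galM // gal_block.
rewrite er in rb'.
have sbmu := gal_unity_root s bmu.
have tsb : rigid (s (base_point y)) by apply: rigid_gal => //; apply: rigid_block yb ty.
have sb : orb (s (base_point y)) (base_point (s y)).
  apply: (orb_trans sbmu) rb'; apply: (orb_sym rmu).
  by apply: (orb_trans rmu rb); apply/orbP; exists s.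
have /orbP[u uH ub] := sb; rewrite ub; apply: (rigidP _ tsb) => //; rewrite -ub.
apply: (block_trans prz sbmu _ syb'); apply: (block_sym prz symu).
by rewrite gal_block.
Qed.

(** * Elements fixed by the automorphisms *)

Local Notation W := [seq w <- mu | based f base_point w].
Local Notation Wr := [seq w <- W | rigid w].

Let W_mu w : w \in W -> w \in mu.
Proof. by rewrite mem_filter => /andP[]. Qed.

Let W_uniq : uniq W.
Proof. exact/filter_uniq/(uniq_unity_roots prz). Qed.

Let Wr_mu w : w \in Wr -> w \in mu.
Proof. by rewrite mem_filter => /andP[_ /W_mu]. Qed.

Let Wr_uniq : uniq Wr.
Proof. exact/filter_uniq/W_uniq. Qed.

Let W_free : free W.
Proof. exact: (based_free prz base_point_block base_point_const). Qed.

Lemma gal_perm_unity_roots s : perm_eq (map s mu) mu.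
Proof. exact: perm_unity_roots. Qed.

Lemma gal_rigid_based s w : s \in H -> w \in Wr -> s w \in Wr.
Proof.
move=> sH; rewrite !mem_filter => /and3P[tw /andP[fw fv] wmu].
have swmu := gal_unity_root s wmu; rewrite swmu rigid_gal // /based.
rewrite base_point_gal // rmorph_full fw rmorph_wild -fmorph_div.
by rewrite rmorph_full fv.
Qed.

Lemma perm_rigid_based s : s \in H -> perm_eq (map s Wr) Wr.
Proof.
move=> sH; have us : uniq (map s Wr) by rewrite map_inj_uniq //; apply: fmorph_inj.
apply: (uniq_perm us Wr_uniq).
have sub : {subset map s Wr <= Wr}.
  by move=> _ /mapP[y yW ->]; apply: gal_rigid_based.
have sz : (size Wr <= size (map s Wr))%N by rewrite size_map.
exact: (uniq_min_size us sub sz).2.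
Qed.

(** Some automorphism [s] in [H] preserves the block of [w] and acts on it as a
    scalar [u != 1]. The component [X] in this block of an element fixed by [s]
    satisfies [X = u * X], and so it vanishes. *)
Lemma fixed_nonrigid_coef (c : E -> int) w :
    (forall s, s \in H -> s (\sum_(w <- W) w *~ c w) = \sum_(w <- W) w *~ c w) ->
  w \in W -> ~~ rigid w -> c w = 0.
Proof.
move=> fixc Ww; rewrite /rigid negb_forall_in => /exists_inP[s sH].
rewrite negb_imply => /andP[bs sw]; have wmu := W_mu Ww.
have w0 := unity_root_neq0 prz wmu.
(* d extends the coefficients by zero from the based roots to all roots. *)
pose d y := if based f base_point y then c y else 0.
have based_full y : based f base_point y -> full f y by case/andP.
have sumd (B : pred E) : \sum_(y <- mu | full f y && B y) y *~ d y
    = \sum_(y <- W | B y) y *~ c y.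
  rewrite big_filter_cond [RHS]big_mkcond [LHS]big_mkcond /=; apply: eq_bigr => y _.
  rewrite /d; case: (boolP (based f base_point y)) => [/[dup] By /based_full -> //|_].
  by rewrite mulr0z if_same.
have sumW : \sum_(y <- mu | full f y) y *~ d y = \sum_(y <- W) y *~ c y.
  by rewrite -(sumd xpredT); apply: eq_bigl => y; rewrite andbT.
have shift (B : pred E) :
    \sum_(y <- mu | full f y && B y) y *~ d ((s^-1)%g y)
    = \sum_(y <- mu | full f y && B (s y)) s y *~ d y.
  rewrite -(perm_big _ (gal_perm_unity_roots s)) big_map.
  rewrite big_seq_cond [RHS]big_seq_cond; apply: eq_big => y.
    by rewrite rmorph_full.
  by case/andP=> ymu _; rewrite galVK.
have dif : \sum_(y <- mu | full f y) y *~ (d y - d ((s^-1)%g y)) = 0.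
  under eq_bigr do rewrite mulrzBr.
  rewrite sumrB sumW; apply/eqP; rewrite subr_eq0; apply/eqP.
  have := shift xpredT; under eq_bigl do rewrite andbT.
  under [in RHS]eq_bigl do rewrite andbT.
  move=> ->; rewrite -{1}(fixc s sH) -sumW raddf_sum; apply: eq_bigr => y _.
  by rewrite raddfMz.
have := block_direct prz base_point_block base_point_const wmu dif.
under eq_bigr do rewrite mulrzBr.
rewrite sumrB shift; set X := \sum_(y <- mu | _) y *~ _.
have -> : \sum_(y <- mu | full f y && block f w (s y)) s y *~ d y = s w / w * X.
  rewrite mulr_sumr big_seq_cond [RHS]big_seq_cond; apply: eq_big => y.
    case: (boolP (y \in mu)) => //= ymu; congr (_ && _).
    apply/idP/idP => [wsy | wy].
      rewrite -(gal_block s).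
      exact: (block_trans prz (gal_unity_root s wmu) (block_sym prz wmu bs) wsy).
    by apply: (block_trans prz wmu bs); rewrite gal_block.
  case/and3P=> ymu _; case: (boolP (block f w (s y))) => // wsy _.
  have wy : block f w y.
    rewrite -(gal_block s).
    exact: (block_trans prz (gal_unity_root s wmu) (block_sym prz wmu bs) wsy).
  have v1 : s (y / w) = y / w by apply: (gal_block_scalar wmu bs); apply/eqP.
  rewrite mulrzAr; congr (_ *~ _).
  by rewrite -{1}(divfK w0 y) rmorphM /= v1; ring.
move=> /eqP; rewrite -{1}[X]mul1r -mulrBl mulf_eq0 subr_eq0 => /orP[/eqP u1|].
  by rewrite -(divfK w0 (s w)) -u1 mul1r eqxx in sw.
rewrite /X sumd => /eqP X0.
have c0 : \sum_(y <- W) y *~ (if block f w y then c y else 0) = 0.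
  rewrite -[RHS]X0 [RHS]big_mkcond; apply: eq_bigr => y _.
  by case: ifP; rewrite ?mulr0z.
by have := free_Zindep W_free c0 Ww; rewrite (block_refl prz).
Qed.

(** The based roots in rigid blocks are permuted by [H], and free. *)
Lemma fixed_rigid_coef (c : E -> int) :
    (forall s, s \in H -> s (\sum_(w <- W) w *~ c w) = \sum_(w <- W) w *~ c w) ->
  {in Wr & H, forall w s, c (s w) = c w}.
Proof.
move=> fixc w s Ww sH.
have sumT : \sum_(w <- W) w *~ c w = \sum_(w <- Wr) w *~ c w.
  rewrite [RHS]big_filter [RHS]big_mkcond [LHS]big_seq [RHS]big_seq /=.
  apply: eq_bigr => y Wy.
  by case: (boolP (rigid y)) => // /(fixed_nonrigid_coef fixc Wy) ->; rewrite mulr0z.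
have Wr_free : free Wr by rewrite filter_free.
have := fixc (s^-1)%g (groupVr sH); rewrite sumT raddf_sum.
rewrite -[LHS](perm_big _ (perm_rigid_based sH)) big_map => e.
have : \sum_(w <- Wr) w *~ (c (s w) - c w) = 0.
  under eq_bigr do rewrite mulrzBr.
  rewrite sumrB -e; apply/eqP; rewrite subr_eq0; apply/eqP.
  rewrite big_seq [RHS]big_seq; apply: eq_bigr => y /Wr_mu ymu.
  by rewrite raddfMz /= galVK.
by move/(free_Zindep Wr_free)/(_ w Ww)/eqP; rewrite subr_eq0 => /eqP.
Qed.

Definition orb_rep w : E := head 1 [seq t <- Wr | orb w t].

Local Notation reps := [seq w <- Wr | orb_rep w == w].

Lemma orb_repP w : w \in Wr -> (orb_rep w \in Wr) && orb w (orb_rep w).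
Proof. by move=> Ww; apply: (head_filterP 1 Ww); apply: orb_refl. Qed.

Lemma orb_rep_eq w t : w \in mu -> orb w t -> orb_rep t = orb_rep w.
Proof.
move=> wmu wt; congr (head _ _); apply: eq_filter => u.
have tmu : t \in mu by case/orbP: wt => s _ ->; apply: gal_unity_root.
by apply/idP/idP; apply: orb_trans => //; apply: orb_sym.
Qed.

Lemma orbit_sumE w : w \in Wr -> orbit_sum H w = \sum_(t <- Wr | orb w t) t.
Proof.
move=> Ww; rewrite /orbit_sum -[RHS]big_filter; apply: perm_big.
apply: uniq_perm; [exact: undup_uniq | exact/filter_uniq/Wr_uniq |] => t.
rewrite mem_undup mem_filter; apply/idP/andP => [/imageP[s sH ->]|[] //].
split; last exact: gal_rigid_based.
by apply/orbP; exists s.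
Qed.

(** The orbit of [orb_rep t] is the only one of the given orbits containing [t]. *)
Lemma orbit_sum_reps (d : E -> int) :
  \sum_(w <- reps) orbit_sum H w *~ d w = \sum_(t <- Wr) t *~ d (orb_rep t).
Proof.
transitivity (\sum_(w <- reps) \sum_(t <- Wr | orb w t) t *~ d w).
  rewrite big_seq [RHS]big_seq; apply: eq_bigr => w.
  by rewrite mem_filter => /andP[_ Ww]; rewrite orbit_sumE // mulrz_suml.
rewrite (exchange_big_dep xpredT) //= big_seq [RHS]big_seq.
apply: eq_bigr => t Wr_t; have /andP[Wr_r tr] := orb_repP Wr_t.
have tmu := Wr_mu Wr_t; have rmu := Wr_mu Wr_r.
have rr : orb_rep t \in reps by rewrite mem_filter Wr_r (orb_rep_eq tmu tr) eqxx.
rewrite big_mkcond (bigD1_seq (orb_rep t) rr (filter_uniq _ Wr_uniq)) /=.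
rewrite (orb_sym tmu tr) big_seq_cond big1 ?addr0 // => w.
rewrite mem_filter => /andP[/andP[/eqP wr Ww] wt]; case: ifP => // owt.
by rewrite (orb_rep_eq (Wr_mu Ww) owt) wr eqxx in wt.
Qed.

Lemma orbit_sum_free (d : E -> int) :
  \sum_(w <- reps) orbit_sum H w *~ d w = 0 -> {in reps, forall w, d w = 0}.
Proof.
have Wr_free : free Wr by rewrite filter_free.
rewrite orbit_sum_reps => /(free_Zindep Wr_free) d0 w.
by rewrite mem_filter => /andP[/eqP wr Ww]; rewrite -wr d0.
Qed.

(** The coefficients of [x] vanish on the blocks that are not rigid, and are
    constant on the orbits of based roots in the rigid blocks. *)
Lemma orbit_sum_spans x : Zadjoin z x -> (forall s, s \in H -> s x = x) ->
  exists d : E -> int, x = \sum_(w <- reps) orbit_sum H w *~ d w.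
Proof.
move=> /(Zadjoin_Zspan prz base_point_block base_point_const)[c ->] fixc.
exists c; rewrite orbit_sum_reps.
rewrite [RHS]big_filter [RHS]big_mkcond [LHS]big_seq [RHS]big_seq /=.
apply: eq_bigr => w Ww; case: (boolP (rigid w)) => tw; last first.
  by rewrite (fixed_nonrigid_coef fixc Ww tw) mulr0z.
have Wrw : w \in Wr by rewrite mem_filter tw.
have /andP[_ /orbP[s sH ->]] := orb_repP Wrw.
by rewrite fixed_rigid_coef.
Qed.

Definition orbit_reps : seq E := reps.

Lemma orbit_reps_uniq : uniq orbit_reps.
Proof. exact/filter_uniq/Wr_uniq. Qed.

Lemma orbit_reps_unity_root w : w \in orbit_reps -> w \in mu.
Proof. by rewrite mem_filter => /andP[_ /Wr_mu]. Qed.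

Lemma orbit_sum_fixed w s : w \in orbit_reps -> s \in H ->
  s (orbit_sum H w) = orbit_sum H w.
Proof.
rewrite mem_filter => /andP[_ Ww] sH.
rewrite orbit_sumE // raddf_sum -[RHS](perm_big _ (perm_rigid_based sH)).
rewrite big_map big_seq_cond [RHS]big_seq_cond; apply: eq_bigl => t.
case: (boolP (t \in Wr)) => //= Wr_t; have tmu := Wr_mu Wr_t.
have tst : orb t (s t) by apply/orbP; exists s.
apply/idP/idP => wt; apply: (orb_trans (Wr_mu Ww) wt) => //.
exact: orb_sym.
Qed.

Lemma orbit_sum_ind (S : E -> Prop) w :
    S 0 -> (forall x y, S x -> S y -> S (x + y)) ->
    {in mu, forall y, S y} -> w \in mu ->
  S (orbit_sum H w).
Proof.
move=> S0 SD Smu wmu; rewrite /orbit_sum big_seq; apply: big_ind => // y.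
by rewrite mem_undup => /imageP[s _ ->]; apply/Smu/gal_unity_root.
Qed.

End OrbitBasis.

(** * The integral basis *)

Lemma Z_basis_seq (V : zmodType) (M : V -> Prop) (T : eqType) (x0 : T)
    (s : seq T) (b : T -> V) : uniq s ->
    (forall d : T -> int, \sum_(t <- s) b t *~ d t = 0 -> {in s, forall t, d t = 0}) ->
    (forall x, M x <-> exists d : T -> int, x = \sum_(t <- s) b t *~ d t) ->
  is_Z_basis M (fun i : 'I_(size s) => b (nth x0 s i)).
Proof.
move=> us indep span.
have sumE (d : T -> int) : \sum_(t <- s) b t *~ d t
    = \sum_(i < size s) b (nth x0 s i) *~ d (nth x0 s i).
  by rewrite (big_nth x0) big_mkord.
have ext (c : 'I_(size s) -> int) : exists d : T -> int,
    forall i : 'I_(size s), d (nth x0 s i) = c i.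
  exists (fun t => oapp c 0 (insub (index t s))) => i.
  by rewrite index_uniq // valK.
split=> [c c0 i | x].
  have [d dc] := ext c; rewrite -dc; apply: indep; last exact: mem_nth.
  by rewrite sumE -[RHS]c0; apply: eq_bigr => j _; rewrite dc.
rewrite span; split=> [[d ->] | [c ->]].
  by exists (fun i => d (nth x0 s i)); rewrite sumE.
have [d dc] := ext c; exists d; rewrite sumE.
by apply: eq_bigr => j _; rewrite dc.
Qed.

Theorem theorem4p5p1 (R : realType) (E : splittingFieldType rat)
    (iota : {rmorphism E -> R[i]}) (L : {subfield E})
    (galL : galois 1 L) (abelL : abelian 'Gal(L / 1)%g)
    (f : nat) (condL : is_conductor iota L f)
    (z : E) (iota_z : iota z = zeta R f) :
  exists (n : nat) (b : 'I_n -> E),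
    is_Z_basis (ring_of_integers L) b /\
    forall i : 'I_n, exists2 eta : E, f.-unity_root eta &
      b i = orbit_sum 'Gal(<<1; z>> / L)%g eta.
Proof.
have [f_gt0 Lf _] := condL.
have prz : f.-primitive_root z.
  by rewrite -(fmorph_primitive_root iota) iota_z; apply: zeta_primitive.
have LK : (L <= <<1; z>>)%VS.
  by apply/subvP => x /Lf; apply: cyclotomic_field_adjoin.
have galK : galois L <<1; z>>.
  by apply: (galoisS _ (galois_cyclotomic prz)); rewrite sub1v.
pose H := 'Gal(<<1; z>> / L)%G.
have /galois_fixedField fixL := galK.
pose s := orbit_reps f H.
have sub (w : E) : w \in s -> w \in unity_roots f z.
  exact: orbit_reps_unity_root.
exists (size s), (fun i => orbit_sum H (nth 1 s i)); split; last first.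
  move=> i; exists (nth 1 s i) => //.
  rewrite unity_rootE -(mem_unity_roots prz); apply: sub; exact: mem_nth.
apply: (Z_basis_seq 1 (b := orbit_sum H)).
- exact: orbit_reps_uniq.
- exact: orbit_sum_free.
move=> x; split=> [[Lx intx] | [d ->]].
  apply: orbit_sum_spans => // [|t tH].
    exact: (cyclotomic_integers prz (subvP LK x Lx) intx).
  by move: Lx; rewrite -{1}fixL => /mem_fixedFieldP[_]; apply.
have sumL (w : E) : w \in s -> orbit_sum H w \in L.
  move=> ws; rewrite -fixL.
  have Kw : orbit_sum H w \in <<1; z>>%VS.
    apply: (@orbit_sum_ind _ _ _ prz H (fun y => y \in <<1; z>>%VS)) (sub w ws).
    - exact: rpred0.
    - by move=> ? ?; apply: rpredD.
    by move=> y; apply: unity_root_adjoin.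
  by apply/(fixedFieldP Kw) => t tH; apply: (orbit_sum_fixed prz).
rewrite big_seq; split.
  apply: rpred_sum => w ws; rewrite -mulrzl.
  by apply: rpredM; [apply: rpred_int | apply: sumL].
apply: big_ind => [||w ws]; [exact: integral0 | exact: integral_add |].
rewrite -mulrzl; apply: integral_mul; first exact: integral_id.
apply: (@orbit_sum_ind _ _ _ prz H (integralOver intr)) (sub w ws).
- exact: integral0.
- exact: integral_add.
move=> y; rewrite (mem_unity_roots prz) => /eqP.
exact: integral_unity_root.
Qed.
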